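(* Suppose that $(\Gamma,d)$ is inner, $da=\omega a-a\omega$ for all $a\in\mathcal A$ with a fixed $\omega\in\Gamma$, and that $\nabla$ is a linear left connection on $\Gamma$ of the form $\nabla(\rho)=\omega\otimes_{\mathcal A}\rho-\tilde\sigma(\rho\otimes_{\mathcal A}\omega)$, $\rho\in\Gamma$, for an endomorphism $\tilde\sigma$ of the $\mathcal A$-bimodule $\Gamma\otimes_{\mathcal A}\Gamma$. Let $\nabla:\Gamma^\otimes\to\Gamma\otimes_{\mathcal A}\Gamma^\otimes$ also denote its extension to the tensor algebra. 1. If $\sigma_{23}\tilde\sigma_{12}\tilde\sigma_{23}=\tilde\sigma_{12}\tilde\sigma_{23}\sigma_{12}$ on $\Gamma^{\otimes_{\mathcal A}3}$, then $\nabla$ is compatible with Woronowicz' antisymmetrizer, i.e. $(\mathrm{id}\otimes A_k)\nabla(\rho_k)=0$ whenever $\rho_k\in\Gamma^{\otimes_{\mathcal A}k}$ and $A_k(\rho_k)=0$, so that $\nabla$ is well defined on $\Gamma^\wedge$. 2. If $\sigma_{23}\tilde\sigma_{12}\tilde\sigma_{23}=\tilde\sigma_{12}\tilde\sigma_{23}\sigma_{12}$ and $g_{23}\tilde\sigma_{12}\tilde\sigma_{23}=g_{12}$ on $\Gamma^{\otimes_{\mathcal A}3}$, then $\nabla$ is compatible with the multiplication of the Clifford algebra, i.e. $\nabla$ descends to a linear left connection on the quantum Clifford algebra $\mathrm{Cl}(\Gamma,\sigma,g)=\Gamma^\otimes/\mathcal I$.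
   Context: $\mathcal A$ is a cosemisimple Hopf $*$-algebra over $\mathbb C$, with coproduct $\varDelta(a)=a_{(1)}\otimes a_{(2)}$, counit $\varepsilon$, antipode $S$. Repeated indices are summed. **Calculus.** $(\Gamma,d)$ is a finite dimensional left-covariant first order differential $*$-calculus over $\mathcal A$; $\Gamma_L$ is the space of left-invariant elements with basis $\theta_1,\dots,\theta_n$, and the quantum tangent space $\mathcal X\subset\mathcal A^\circ$ has the dual basis $X_1,\dots,X_n$, i.e. $da=a_{(1)}X_i(a_{(2)})\theta_i$. It is $S^2$-invariant: $S^2(\mathcal X)=\mathcal X$. If $S^2(X_i)=F^i_jX_j$, put $S^2(\theta_i):=F^j_i\theta_j$, $S^2(a\rho)=S^2(a)S^2(\rho)$. Put $\omega(a)=S(a_{(1)})da_{(2)}$ and $\mathcal R_\Gamma=\{b: \omega(b)=0,\varepsilon(b)=0\}$. **Braiding.** $\sigma$ is an automorphism of the left-covariant $\mathcal A$-bimodule $\Gamma\otimes_{\mathcal A}\Gamma$ such that: $\sigma_{12}\sigma_{23}\sigma_{12}=\sigma_{23}\sigma_{12}\sigma_{23}$; $\omega(a_{(1)})\otimes\omega(a_{(2)})\in\ker(\mathrm{id}-\sigma)$ for $a\in\mathcal R_\Gamma$; $\sigma$ commutes with $S^2$; and either $(\sigma\rho_2)^*=\sigma(\rho_2^* )$ for all $\rho_2$ or $(\sigma\rho_2)^*=\sigma^{-1}(\rho_2^* )$ for all $\rho_2\in\Gamma^{\otimes_{\mathcal A}2}$. $A_k=\sum_{w\in S_k}(-1)^{\ell(w)}\sigma_w$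 is Woronowicz' antisymmetrizer on $\Gamma^{\otimes_{\mathcal A}k}$, and $\Gamma^\wedge=\bigoplus_k\Gamma^{\otimes_{\mathcal A}k}/\ker A_k$. **$\sigma$-metric.** $g:\Gamma\otimes_{\mathcal A}\Gamma\to\mathcal A$ is a non-degenerate homomorphism of left-covariant $\mathcal A$-bimodules with $g\sigma=g$, $g_{12}\sigma^{\pm1}_{23}\sigma^{\pm1}_{12}=g_{23}$ (both signs), $g(\rho\otimes\rho')^*=g(\rho'^*\otimes\rho^* )$, and $g(S^2(\rho')\otimes\rho)=g(\rho\otimes\rho')$ for $\rho,\rho'\in\Gamma_L$. **Clifford algebra.** $\mathrm{Cl}(\Gamma,\sigma,g)=\Gamma^{\otimes}/\mathcal I$, where $\Gamma^\otimes=\bigoplus_k\Gamma^{\otimes_{\mathcal A}k}$ and $\mathcal I$ is the two-sided ideal generated by $\{\rho_2-g(\rho_2): \rho_2\in\Gamma^{\otimes_{\mathcal A}2},\ \sigma(\rho_2)=\rho_2\}$. **Connections.** A left connection on an $\mathcal A$-bimodule $\mathcal C$ is a linear map $\nabla:\mathcal C\to\Gamma\otimes_{\mathcal A}\mathcal C$ with $\nabla(a\rho)=da\otimes\rho+a\nabla(\rho)$. It is a linear left connection if there is a bimodule homomorphism $\tilde\sigma:\mathcal C\otimes_{\mathcal A}\Gamma\to\Gamma\otimes_{\mathcal A}\mathcal C$ with $\tilde\sigma(\rho\otimes da)=\nabla(\rho a)-\nabla(\rho)a$. A linear left connection $\nabla$ on $\Gamma$ is extended to $\Gamma^{\otimes_{\mathcal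 A}k}$, $k\ge2$, recursively by $\nabla(\rho\otimes\rho_{k-1})=\nabla(\rho)\otimes\rho_{k-1}+(\tilde\sigma\otimes\mathrm{id}^{k-1})(\rho\otimes\nabla(\rho_{k-1}))$ (and $\nabla=d$ on $\mathcal A$). If $\mathcal C$ is an $\mathcal A$-bimodule algebra with product $\circ$, a linear left connection on the algebra $\mathcal C$ must in addition satisfy $\nabla(\rho\circ\rho')=(\mathrm{id}\otimes\circ)\bigl(\nabla(\rho)\otimes\rho'+(\tilde\sigma\otimes\mathrm{id})(\rho\otimes\nabla(\rho'))\bigr)$. *)

(* Defs.v *)
From HB Require Import structures.
From mathcomp Require Import all_boot all_order all_algebra perm ring_quotient.
From mathcomp Require Import boolp reals complex.

Set Implicit Arguments.
Unset Strict Implicit.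
Unset Printing Implicit Defensive.

Import GRing.Theory.
Local Open Scope ring_scope.
Local Open Scope quotient_scope.

HB.mixin Record Lmodule_isBimod (A : nzRingType) M of GRing.Lmodule A M := {
  ract : M -> A -> M;
  ractDl : forall a, {morph ract^~ a : x y / x + y};
  ractDr : forall x, {morph ract x : a b / a + b};
  ract1 : forall x, ract x 1 = x;
  ractA : forall x a b, ract (ract x a) b = ract x (a * b);
  ractZ : forall a x b, ract (a *: x) b = a *: ract x b
}.

#[short(type="bimodType")]
HB.structure Definition Bimod (A : nzRingType) :=
  {M of Lmodule_isBimod A M & GRing.Lmodule A M}.

Notation "x :* a" := (ract x a) : ring_scope.

Section RegularBimod.
Variable A : nzRingType.
Let rmul (x : A^o) (a : A) : A^o := (x : A) * a.
Let rmulDl a : {morph rmul^~ a : x y / x + y}.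
Proof. by move=> x y; exact: mulrDl. Qed.
Let rmulDr x : {morph rmul x : a b / a + b}.
Proof. by move=> a b; exact: mulrDr. Qed.
Let rmul1 x : rmul x 1 = x. Proof. exact: mulr1. Qed.
Let rmulA x a b : rmul (rmul x a) b = rmul x (a * b).
Proof. by rewrite /rmul mulrA. Qed.
Let rmulZ a x b : rmul (a *: x) b = a *: rmul x b.
Proof. exact: esym (mulrA _ _ _). Qed.
HB.instance Definition _ :=
  Lmodule_isBimod.Build A A^o rmulDl rmulDr rmul1 rmulA rmulZ.
End RegularBimod.

Definition bimod_hom (A : nzRingType) (M N : bimodType A) (f : M -> N) : Prop :=
  [/\ {morph f : x y / x + y}, forall a, {morph f : x / a *: x}
    & forall a, {morph f : x / x :* a}].

Section BimodTheory.
Variables (A : nzRingType) (M : bimodType A).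
Implicit Types (x y : M) (a b : A).

Lemma ract0l a : (0 : M) :* a = 0.
Proof. by apply: (@addrI _ ((0 : M) :* a)); rewrite -ractDl !addr0. Qed.

Lemma ract0r x : x :* 0 = 0.
Proof. by apply: (@addrI _ (x :* 0)); rewrite -ractDr !addr0. Qed.

Lemma ractNl x a : (- x) :* a = - (x :* a).
Proof. by apply/eqP; rewrite -addr_eq0 -ractDl addNr ract0l. Qed.

Lemma ract_sum I (r : seq I) (P : pred I) (F : I -> M) a :
  (\sum_(i <- r | P i) F i) :* a = \sum_(i <- r | P i) F i :* a.
Proof. exact: (big_morph (fun x : M => x :* a) (ractDl a) (ract0l a)). Qed.
End BimodTheory.

Section Tensor.
Variables (A : nzRingType) (M N : bimodType A).

(* A list stands for the formal sum of the pure tensors it contains. *)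
Inductive tens_eq : seq (M * N) -> seq (M * N) -> Prop :=
| tens_refl s : tens_eq s s
| tens_sym s t : tens_eq s t -> tens_eq t s
| tens_trans s t u : tens_eq s t -> tens_eq t u -> tens_eq s u
| tens_cat s s' t t' : tens_eq s s' -> tens_eq t t' -> tens_eq (s ++ t) (s' ++ t')
| tens_comm s t : tens_eq (s ++ t) (t ++ s)
| tens_0 y : tens_eq [:: (0, y)] [::]
| tens_Dl x x' y : tens_eq [:: (x + x', y)] [:: (x, y); (x', y)]
| tens_Dr x y y' : tens_eq [:: (x, y + y')] [:: (x, y); (x, y')]
| tens_bal x a y : tens_eq [:: (x :* a, y)] [:: (x, a *: y)].

Definition tens_eqb : rel (seq (M * N)) := fun s t => `[< tens_eq s t >].

Lemma tens_eqb_equiv : equiv_class_of tens_eqb.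
Proof.
split=> [s|s t|t s u].
- by apply/asboolP; exact: tens_refl.
- by apply/idP/idP => /asboolP h; apply/asboolP; exact: tens_sym.
- by move=> /asboolP h1 /asboolP h2; apply/asboolP; exact: tens_trans h1 h2.
Qed.

Canonical tens_eqb_rel := EquivRelPack tens_eqb_equiv.

Definition btens := {eq_quot tens_eqb_rel}.
HB.instance Definition _ := Choice.on btens.
HB.instance Definition _ := EqQuotient.on btens.

Lemma tens_piP s t : tens_eq s t <-> \pi_btens s = \pi_btens t.
Proof.
split=> [h|/eqmodP h].
  by apply/eqmodP; apply/asboolP.
by apply/asboolP.
Qed.

Lemma tens_repr s : tens_eq (repr (\pi_btens s)) s.
Proof. by apply/tens_piP; rewrite reprK. Qed.

Definition tens_opp (x : btens) : btens :=
  \pi_btens [seq (- p.1, p.2) | p <- repr x].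
Definition tens_add (x y : btens) : btens := \pi_btens (repr x ++ repr y).
Definition tens_zero : btens := \pi_btens [::].
Definition tens_lact (a : A) (x : btens) : btens :=
  \pi_btens [seq (a *: p.1, p.2) | p <- repr x].
Definition tens_ract (x : btens) (a : A) : btens :=
  \pi_btens [seq (p.1, p.2 :* a) | p <- repr x].

Lemma tens_map (f : M * N -> M * N) :
    (forall y, tens_eq [:: f (0, y)] [::]) ->
    (forall x x' y, tens_eq [:: f (x + x', y)] [:: f (x, y); f (x', y)]) ->
    (forall x y y', tens_eq [:: f (x, y + y')] [:: f (x, y); f (x, y')]) ->
    (forall x a y, tens_eq [:: f (x :* a, y)] [:: f (x, a *: y)]) ->
  forall s t, tens_eq s t -> tens_eq (map f s) (map f t).
Proof.
move=> f0 fDl fDr fb s t; elim=> {s t} /=.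
- by move=> s; exact: tens_refl.
- by move=> s t _; exact: tens_sym.
- by move=> s t u _ h1 _; exact: tens_trans.
- by move=> s s' t t' _ h1 _ h2; rewrite !map_cat; exact: tens_cat.
- by move=> s t; rewrite !map_cat; exact: tens_comm.
- exact: f0.
- exact: fDl.
- exact: fDr.
- exact: fb.
Qed.

Lemma tens_oppE s : tens_opp (\pi_btens s) = \pi_btens [seq (- p.1, p.2) | p <- s].
Proof.
apply/tens_piP; apply: tens_map (tens_repr s) => /= [y|x x' y|x y y'|x a y].
- by rewrite oppr0; exact: tens_0.
- by rewrite opprD; exact: tens_Dl.
- exact: tens_Dr.
- by rewrite -ractNl; exact: tens_bal.
Qed.

Lemma tens_addE s t : tens_add (\pi_btens s) (\pi_btens t) = \pi_btens (s ++ t).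
Proof. by apply/tens_piP; apply: tens_cat; exact: tens_repr. Qed.

Lemma tens_lactE a s :
  tens_lact a (\pi_btens s) = \pi_btens [seq (a *: p.1, p.2) | p <- s].
Proof.
apply/tens_piP; apply: tens_map (tens_repr s) => /= [y|x x' y|x y y'|x b y].
- by rewrite scaler0; exact: tens_0.
- by rewrite scalerDr; exact: tens_Dl.
- exact: tens_Dr.
- by rewrite -ractZ; exact: tens_bal.
Qed.

Lemma tens_ractE a s :
  tens_ract (\pi_btens s) a = \pi_btens [seq (p.1, p.2 :* a) | p <- s].
Proof.
apply/tens_piP; apply: tens_map (tens_repr s) => /= [y|x x' y|x y y'|x b y].
- exact: tens_0.
- exact: tens_Dl.
- by rewrite ractDl; exact: tens_Dr.
- by rewrite ractZ; exact: tens_bal.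
Qed.

Lemma tensW (P : btens -> Prop) : (forall s, P (\pi_btens s)) -> forall x, P x.
Proof. by move=> h x; rewrite -[x]reprK. Qed.

Lemma tens_addA : associative tens_add.
Proof.
elim/tensW=> s; elim/tensW=> t; elim/tensW=> u.
by rewrite !tens_addE catA.
Qed.

Lemma tens_addC : commutative tens_add.
Proof.
elim/tensW=> s; elim/tensW=> t; rewrite !tens_addE.
by apply/tens_piP; exact: tens_comm.
Qed.

Lemma tens_add0 : left_id tens_zero tens_add.
Proof. by elim/tensW=> s; rewrite /tens_zero tens_addE. Qed.

Lemma tens_addN : left_inverse tens_zero tens_opp tens_add.
Proof.
elim/tensW=> s; rewrite tens_oppE tens_addE; apply/tens_piP.
elim: s => [|[x y] s IHs] /=; first exact: tens_refl.
set t := map _ s in IHs *.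
apply: (@tens_trans _ ([:: (- x, y); (x, y)] ++ (t ++ s))).
  change (tens_eq ([:: (- x, y)] ++ (t ++ (x, y) :: s))
                  ([:: (- x, y)] ++ ([:: (x, y)] ++ t ++ s))).
  apply: tens_cat; first exact: tens_refl.
  by rewrite -cat1s !catA; apply: tens_cat; [exact: tens_comm|exact: tens_refl].
apply: (@tens_trans _ ([::] ++ [::])); last exact: tens_refl.
apply: tens_cat IHs; apply: (@tens_trans _ [:: (- x + x, y)]).
  by apply: tens_sym; exact: tens_Dl.
by rewrite addNr; exact: tens_0.
Qed.

HB.instance Definition _ :=
  GRing.isZmodule.Build btens tens_addA tens_addC tens_add0 tens_addN.

Lemma tens_piD s t : \pi_btens (s ++ t) = \pi_btens s + \pi_btens t.
Proof. by rewrite -tens_addE. Qed.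

Lemma tens_pi0 : \pi_btens [::] = 0. Proof. by []. Qed.

Definition pure (x : M) (y : N) : btens := \pi_btens [:: (x, y)].
Local Notation "x \ot y" := (pure x y) (at level 40, left associativity).

Lemma tens_piE s : \pi_btens s = \sum_(p <- s) p.1 \ot p.2.
Proof.
elim: s => [|[x y] s IHs]; first by rewrite big_nil.
by rewrite -cat1s tens_piD IHs big_cat big_seq1.
Qed.

Lemma pureDl x x' y : (x + x') \ot y = x \ot y + x' \ot y.
Proof. by rewrite -tens_piD; apply/tens_piP; exact: tens_Dl. Qed.
Lemma pureDr x y y' : x \ot (y + y') = x \ot y + x \ot y'.
Proof. by rewrite -tens_piD; apply/tens_piP; exact: tens_Dr. Qed.
Lemma pure_bal x a y : (x :* a) \ot y = x \ot (a *: y).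
Proof. by apply/tens_piP; exact: tens_bal. Qed.

Lemma tens_ind (P : btens -> Prop) : P 0 ->
    (forall x y t, P t -> P (x \ot y + t)) -> forall t, P t.
Proof.
move=> P0 PD; elim/tensW; elim=> [|[x y] s IHs]; first by rewrite tens_pi0.
by rewrite -cat1s tens_piD; exact: PD.
Qed.

Lemma tens_lact_morph a : {morph tens_lact a : x y / x + y}.
Proof.
elim/tensW=> s; elim/tensW=> t.
by rewrite -tens_piD !tens_lactE map_cat tens_piD.
Qed.

Lemma tens_lact_pure a x y : tens_lact a (x \ot y) = (a *: x) \ot y.
Proof. by rewrite tens_lactE. Qed.

Lemma tens_lact0 a : tens_lact a 0 = 0. Proof. by rewrite -tens_pi0 tens_lactE. Qed.

Lemma tens_ract_morph a : {morph tens_ract^~ a : x y / x + y}.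
Proof.
elim/tensW=> s; elim/tensW=> t /=.
by rewrite -tens_piD !tens_ractE map_cat tens_piD.
Qed.

Lemma tens_ract_pure a x y : tens_ract (x \ot y) a = x \ot (y :* a).
Proof. by rewrite tens_ractE. Qed.

Lemma tens_ract0 a : tens_ract 0 a = 0. Proof. by rewrite -tens_pi0 tens_ractE. Qed.

Lemma tens_lactA a b x : tens_lact a (tens_lact b x) = tens_lact (a * b) x.
Proof.
elim/tens_ind: x => [|x y t IH]; first by rewrite !tens_lact0.
by rewrite !tens_lact_morph IH !tens_lact_pure scalerA.
Qed.

Lemma tens_lact1 : left_id 1 tens_lact.
Proof.
elim/tens_ind=> [|x y t IH]; first by rewrite tens_lact0.
by rewrite tens_lact_morph IH tens_lact_pure scale1r.
Qed.

Lemma tens_lactDr : right_distributive tens_lact +%R.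
Proof. by move=> a x y; exact: tens_lact_morph. Qed.

Lemma tens_lactDl x : {morph tens_lact^~ x : a b / a + b}.
Proof.
move=> a b /=; elim/tens_ind: x => [|x y t IH]; first by rewrite !tens_lact0 addr0.
by rewrite !tens_lact_morph IH !tens_lact_pure scalerDl pureDl addrACA.
Qed.

HB.instance Definition _ := GRing.Zmodule_isLmodule.Build A btens
  tens_lactA tens_lact1 tens_lactDr tens_lactDl.

Lemma tens_ractDr x : {morph tens_ract x : a b / a + b}.
Proof.
move=> a b /=; elim/tens_ind: x => [|x y t IH]; first by rewrite !tens_ract0 addr0.
by rewrite !tens_ract_morph IH !tens_ract_pure ractDr pureDr addrACA.
Qed.

Lemma tens_ract1 x : tens_ract x 1 = x.
Proof.
elim/tens_ind: x => [|x y t IH]; first by rewrite tens_ract0.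
by rewrite tens_ract_morph IH tens_ract_pure ract1.
Qed.

Lemma tens_ractA x a b : tens_ract (tens_ract x a) b = tens_ract x (a * b).
Proof.
elim/tens_ind: x => [|x y t IH]; first by rewrite !tens_ract0.
by rewrite !tens_ract_morph IH !tens_ract_pure ractA.
Qed.

Lemma tens_ractZ a x b : tens_ract (a *: x) b = a *: tens_ract x b.
Proof.
change (tens_ract (tens_lact a x) b = tens_lact a (tens_ract x b)).
elim/tens_ind: x => [|x y t IH]; first by rewrite tens_lact0 !tens_ract0 tens_lact0.
rewrite tens_lact_morph !tens_ract_morph tens_lact_morph IH.
by rewrite !(tens_lact_pure, tens_ract_pure).
Qed.

HB.instance Definition _ := Lmodule_isBimod.Build A btens
  tens_ract_morph tens_ractDr tens_ract1 tens_ractA tens_ractZ.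

Lemma pureZ a x y : a *: (x \ot y) = (a *: x) \ot y.
Proof. exact: tens_lact_pure. Qed.
Lemma pureR a x y : (x \ot y) :* a = x \ot (y :* a).
Proof. exact: tens_ract_pure. Qed.

Lemma pure0l y : 0 \ot y = 0.
Proof. by apply: (@addrI _ (0 \ot y)); rewrite -pureDl !addr0. Qed.
Lemma pure0r x : x \ot 0 = 0.
Proof. by apply: (@addrI _ (x \ot 0)); rewrite -pureDr !addr0. Qed.

Section Lift.
Variable G : zmodType.

Record balanced (f : M -> N -> G) : Prop := Balanced {
  balDl : forall x x' y, f (x + x') y = f x y + f x' y;
  balDr : forall x y y', f x (y + y') = f x y + f x y';
  balZ : forall x a y, f (x :* a) y = f x (a *: y) }.

(* For a balanced map f this is the induced additive map (tlift_pure, tliftD);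
   for other f the value depends on the chosen representative. *)
Definition tlift (f : M -> N -> G) (t : btens) : G :=
  \sum_(p <- repr t) f p.1 p.2.

Variables (f : M -> N -> G) (fb : balanced f).

Lemma tens_eq_sum s t : tens_eq s t ->
  \sum_(p <- s) f p.1 p.2 = \sum_(p <- t) f p.1 p.2.
Proof.
elim=> {s t} //=.
- by move=> s t u _ -> _ ->.
- by move=> s s' t t' _ h1 _ h2; rewrite !big_cat /= h1 h2.
- by move=> s t; rewrite !big_cat /= addrC.
- move=> y; rewrite big_nil big_seq1 /=.
  by apply: (@addrI _ (f 0 y)); rewrite -(balDl fb) !addr0.
- by move=> x x' y; rewrite !big_cons !big_nil /= !addr0 (balDl fb).
- by move=> x y y'; rewrite !big_cons !big_nil /= !addr0 (balDr fb).
- by move=> x a y; rewrite !big_seq1 /= (balZ fb).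
Qed.

Lemma tlift_pi s : tlift f (\pi_btens s) = \sum_(p <- s) f p.1 p.2.
Proof. exact: tens_eq_sum (tens_repr s). Qed.

Lemma tlift_pure x y : tlift f (x \ot y) = f x y.
Proof. by rewrite tlift_pi big_seq1. Qed.

Lemma tliftD : {morph tlift f : s t / s + t}.
Proof. by elim/tensW=> s; elim/tensW=> t; rewrite -tens_piD !tlift_pi big_cat. Qed.

Lemma tlift0 : tlift f 0 = 0.
Proof. by rewrite -tens_pi0 tlift_pi big_nil. Qed.
End Lift.
End Tensor.

Notation "x \ot y" := (pure x y) (at level 40, left associativity) : ring_scope.

Section TensorMaps.
Variable A : nzRingType.

Definition tmap (M M' N N' : bimodType A) (f : M -> M') (h : N -> N') :
  btens M N -> btens M' N' := tlift (fun x y => f x \ot h y).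

Definition tassoc (M N P : bimodType A) (t : btens (btens M N) P) :
    btens M (btens N P) :=
  tlift (fun (u : btens M N) (z : P) => tlift (fun x y => x \ot (y \ot z)) u) t.

Definition tassocV (M N P : bimodType A) (t : btens M (btens N P)) :
    btens (btens M N) P :=
  tlift (fun (x : M) (u : btens N P) => tlift (fun y z => (x \ot y) \ot z) u) t.

End TensorMaps.

(* A left module over a K-algebra A, as a K-bimodule with equal left and right
   actions; a tensor product of such bimodules is a tensor product over K. *)
Section CentralBimod.
Variables (K : comNzRingType) (A : algType K) (M : lmodType A).

Definition cbim : Type := M.
HB.instance Definition _ := GRing.Zmodule.copy cbim M.

Let cact (c : K) (x : cbim) : cbim := (c%:A : A) *: (x : M).
Let cactA a b x : cact a (cact b x) = cact (a * b) x.
Proof. by rewrite /cact scalerA -scalerAl mul1r scalerA. Qed.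
Let cact1 : left_id 1 cact.
Proof. by move=> x; rewrite /cact scale1r; exact: (@scale1r A M). Qed.
Let cactDr : right_distributive cact +%R.
Proof. by move=> a x y; exact: (@scalerDr A M). Qed.
Let cactDl x : {morph cact^~ x : a b / a + b}.
Proof. by move=> a b; rewrite /cact scalerDl; exact: (@scalerDl A M). Qed.
HB.instance Definition _ := GRing.Zmodule_isLmodule.Build K cbim cactA cact1 cactDr cactDl.

Let cract (x : cbim) (c : K) : cbim := c *: x.
Let cractDl c : {morph cract^~ c : x y / x + y}.
Proof. by move=> x y; exact: scalerDr. Qed.
Let cractDr x : {morph cract x : a b / a + b}.
Proof. by move=> a b; exact: scalerDl. Qed.
Let cract1 x : cract x 1 = x. Proof. exact: scale1r. Qed.
Let cractA x a b : cract (cract x a) b = cract x (a * b).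
Proof. by rewrite /cract scalerA mulrC. Qed.
Let cractZ a x b : cract (a *: x) b = a *: cract x b.
Proof. by rewrite /cract !scalerA mulrC. Qed.
HB.instance Definition _ :=
  Lmodule_isBimod.Build K cbim cractDl cractDr cract1 cractA cractZ.
End CentralBimod.

Section DirectSum.
Variables (A : nzRingType) (F : nat -> bimodType A).

Record dsum := DSum {
  dcoef :> forall k, F k;
  dfin : exists n, forall k, (n <= k)%N -> dcoef k = 0 }.

HB.instance Definition _ := gen_eqMixin dsum.
HB.instance Definition _ := gen_choiceMixin dsum.

Lemma dsumP (x y : dsum) : (forall k, x k = y k) -> x = y.
Proof.
case: x y => [x hx] [y hy] /= h; have e : x = y by exact: functional_extensionality_dep.
by rewrite e in hx *; congr DSum; exact: Prop_irrelevance.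
Qed.

Fact dzero_fin : exists n, forall k, (n <= k)%N -> (0 : F k) = 0.
Proof. by exists 0%N. Qed.
Definition dzero := DSum dzero_fin.

Fact dopp_fin (x : dsum) : exists n, forall k, (n <= k)%N -> - x k = 0.
Proof. by have [n h] := dfin x; exists n => k /h ->; rewrite oppr0. Qed.
Definition dopp x := DSum (dopp_fin x).

Fact dadd_fin (x y : dsum) : exists n, forall k, (n <= k)%N -> x k + y k = 0.
Proof.
have [n h] := dfin x; have [m h'] := dfin y; exists (maxn n m) => k.
by rewrite geq_max => /andP[/h -> /h' ->]; rewrite addr0.
Qed.
Definition dadd x y := DSum (dadd_fin x y).

Let daddA : associative dadd. Proof. by move=> x y z; apply: dsumP => k; exact: addrA. Qed.
Let daddC : commutative dadd. Proof. by move=> x y; apply: dsumP => k; exact: addrC. Qed.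
Let dadd0 : left_id dzero dadd. Proof. by move=> x; apply: dsumP => k; exact: add0r. Qed.
Let daddN : left_inverse dzero dopp dadd.
Proof. by move=> x; apply: dsumP => k; exact: addNr. Qed.
HB.instance Definition _ := GRing.isZmodule.Build dsum daddA daddC dadd0 daddN.

Fact dlact_fin a (x : dsum) : exists n, forall k, (n <= k)%N -> a *: x k = 0.
Proof. by have [n h] := dfin x; exists n => k /h ->; rewrite scaler0. Qed.
Definition dlact a x := DSum (dlact_fin a x).

Let dlactA a b x : dlact a (dlact b x) = dlact (a * b) x.
Proof. by apply: dsumP => k; exact: scalerA. Qed.
Let dlact1 : left_id 1 dlact.
Proof. by move=> x; apply: dsumP => k; exact: scale1r. Qed.
Let dlactDr : right_distributive dlact +%R.
Proof. by move=> a x y; apply: dsumP => k; exact: scalerDr. Qed.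
Let dlactDl x : {morph dlact^~ x : a b / a + b}.
Proof. by move=> a b; apply: dsumP => k; exact: scalerDl. Qed.
HB.instance Definition _ :=
  GRing.Zmodule_isLmodule.Build A dsum dlactA dlact1 dlactDr dlactDl.

Fact dract_fin (x : dsum) a : exists n, forall k, (n <= k)%N -> x k :* a = 0.
Proof. by have [n h] := dfin x; exists n => k /h ->; rewrite ract0l. Qed.
Definition dract x a := DSum (dract_fin x a).

Let dractDl a : {morph dract^~ a : x y / x + y}.
Proof. by move=> x y; apply: dsumP => k; exact: ractDl. Qed.
Let dractDr x : {morph dract x : a b / a + b}.
Proof. by move=> a b; apply: dsumP => k; exact: ractDr. Qed.
Let dract1 x : dract x 1 = x. Proof. by apply: dsumP => k; exact: ract1. Qed.
Let dractA x a b : dract (dract x a) b = dract x (a * b).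
Proof. by apply: dsumP => k; exact: ractA. Qed.
Let dractZ a x b : dract (a *: x) b = a *: dract x b.
Proof. by apply: dsumP => k; exact: ractZ. Qed.
HB.instance Definition _ :=
  Lmodule_isBimod.Build A dsum dractDl dractDr dract1 dractA dractZ.

Lemma dcoefD (x y : dsum) k : (x + y) k = x k + y k. Proof. by []. Qed.
Lemma dcoef0 k : (0 : dsum) k = 0. Proof. by []. Qed.
Lemma dcoefZ a (x : dsum) k : (a *: x) k = a *: x k. Proof. by []. Qed.
Lemma dcoefR a (x : dsum) k : (x :* a) k = x k :* a. Proof. by []. Qed.

Definition dinj_fun k (u : F k) (i : nat) : F i :=
  if k =P i is ReflectT e then ecast i (F i) e u else 0.

Fact dinj_fin k (u : F k) : exists n, forall i, (n <= i)%N -> dinj_fun u i = 0.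
Proof.
exists k.+1 => i lt_ki; rewrite /dinj_fun; case: eqP => // e.
by exfalso; rewrite e ltnn in lt_ki.
Qed.

Definition dinj k (u : F k) : dsum := DSum (dinj_fin u).

Lemma dinj_id k (u : F k) : dinj u k = u.
Proof. by rewrite /= /dinj_fun; case: eqP => // e; rewrite eq_axiomK. Qed.

Lemma dinj_neq k (u : F k) i : k != i -> dinj u i = 0.
Proof. by rewrite /= /dinj_fun; case: eqP. Qed.

Lemma dinjE k i (u : F k) : dinj u i = 0 \/ exists e : k = i, dinj u i = ecast i (F i) e u.
Proof. by rewrite /= /dinj_fun; case: eqP => [e|_]; [right; exists e|left]. Qed.

Lemma dinjD k : {morph @dinj k : u v / u + v}.
Proof.
move=> u v; apply: dsumP => i; rewrite dcoefD; have [<-|ki] := eqVneq k i.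
  by rewrite !dinj_id.
by rewrite !dinj_neq // addr0.
Qed.

Lemma dinjZ k a (u : F k) : dinj (a *: u) = a *: dinj u.
Proof.
apply: dsumP => i; rewrite dcoefZ; have [<-|ki] := eqVneq k i.
  by rewrite !dinj_id.
by rewrite !dinj_neq // scaler0.
Qed.

Lemma dinjR k a (u : F k) : dinj (u :* a) = dinj u :* a.
Proof.
apply: dsumP => i; rewrite dcoefR; have [<-|ki] := eqVneq k i.
  by rewrite !dinj_id.
by rewrite !dinj_neq // ract0l.
Qed.

Lemma dinj0 k : dinj (0 : F k) = 0.
Proof. by apply: (@addrI _ (dinj (0 : F k))); rewrite -dinjD !addr0. Qed.

(* x k = 0 for all k >= dbound x *)
Definition dbound (x : dsum) : nat := sval (cid (dfin x)).

(* The additive map on the direct sum induced by additive maps f k. *)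
Definition dlift (G : zmodType) (f : forall k, F k -> G) (x : dsum) : G :=
  \sum_(k < dbound x) f k (x k).

Lemma dlift_bound (G : zmodType) (f : forall k, F k -> G) (x : dsum) n :
    (forall k, f k 0 = 0) -> (forall k, (n <= k)%N -> x k = 0) ->
  dlift f x = \sum_(k < n) f k (x k).
Proof.
move=> f0 hn; rewrite /dlift; have := svalP (cid (dfin x)); rewrite -/(dbound x) => hm.
wlog le_nm : n {x} x hn hm / (n <= dbound x)%N => [th|].
  have [/th|/ltnW le_mn] := leqP n (dbound x); first exact.
  rewrite [RHS](bigID (fun k : 'I_n => (k < dbound x)%N)) /= [X in _ + X]big1 ?addr0.
    by rewrite -(big_ord_widen _ (fun k => f k (x k))).
  by move=> k; rewrite -leqNgt => /hm ->; exact: f0.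
rewrite (bigID (fun k : 'I_(dbound x) => (k < n)%N)) /= [X in _ + X]big1 ?addr0.
  by rewrite -(big_ord_widen _ (fun k => f k (x k))).
by move=> k; rewrite -leqNgt => /hn ->; exact: f0.
Qed.

Section DLift.
Variables (G : zmodType) (f : forall k, F k -> G).
Hypothesis fD : forall k, {morph @f k : u v / u + v}.

Let f0 k : @f k 0 = 0.
Proof. by apply: (@addrI _ (@f k 0)); rewrite -fD !addr0. Qed.

Lemma dliftD : {morph dlift f : x y / x + y}.
Proof.
move=> x y; have [n h] := dfin x; have [m h'] := dfin y.
rewrite !(@dlift_bound _ _ _ (maxn n m)) //.
- by rewrite -big_split; apply: eq_bigr => i _; rewrite dcoefD fD.
- by move=> k; rewrite geq_max => /andP[_ /h'].
- by move=> k; rewrite geq_max => /andP[/h].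
- by move=> k; rewrite geq_max dcoefD => /andP[/h -> /h' ->]; rewrite addr0.
Qed.

Lemma dlift_dinj k (u : F k) : dlift f (dinj u) = f u.
Proof.
rewrite (@dlift_bound _ _ _ k.+1) //; last first.
  by move=> i ki; rewrite dinj_neq // ltn_eqF.
rewrite big_ord_recr /= -[dinj_fun u k]/(dinj u k) dinj_id big1 ?add0r // => i _.
by rewrite -[dinj_fun u i]/(dinj u i) dinj_neq // gtn_eqF.
Qed.

Lemma dlift0 : dlift f 0 = 0.
Proof. by apply: (@addrI _ (dlift f 0)); rewrite -dliftD !addr0. Qed.
End DLift.

Lemma dsum_ind (P : dsum -> Prop) : P 0 ->
    (forall k (u : F k) x, P x -> P (dinj u + x)) -> forall x, P x.
Proof.
move=> P0 PD x; have [n h] := dfin x.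
suff -> : x = \sum_(k < n) dinj (x k).
  by apply: (big_rec P) => // k y _; exact: PD.
apply: dsumP => i.
have -> : (\sum_(k < n) dinj (x k)) i = \sum_(k < n) dinj (x k) i.
  exact: (big_morph (fun y : dsum => y i)).
have [/h|lt_in] := leqP n i.
  move=> xi0; rewrite xi0 big1 // => k _.
  have [e|ki] := eqVneq (val k) i; last exact: dinj_neq.
  by move: xi0; rewrite -e dinj_id.
rewrite (bigD1 (Ordinal lt_in)) //= -[dinj_fun (x i) i]/(dinj (x i) i) dinj_id.
rewrite big1 ?addr0 // => k ki; exact: dinj_neq.
Qed.
End DirectSum.

(* C is not declared to be a ring, because mathcomp has no join of lmodType and
   pzRingType over a noncommutative ring A in which a *: (x * y) = (a *: x) * y
   is the only compatibility. *)
HB.mixin Record Bimod_isBimodAlg (A : nzRingType) C of Bimod A C := {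
  bone : C;
  bmul : C -> C -> C;
  bmulA : associative bmul;
  bmul1l : left_id bone bmul;
  bmul1r : right_id bone bmul;
  bmulDl : left_distributive bmul +%R;
  bmulDr : right_distributive bmul +%R;
  bmulZ : forall a x y, bmul (a *: x) y = a *: bmul x y;
  bmulR : forall x y a, bmul x (y :* a) = bmul x y :* a;
  bmul_bal : forall x a y, bmul (x :* a) y = bmul x (a *: y)
}.

#[short(type="bimodAlgType")]
HB.structure Definition BimodAlg (A : nzRingType) :=
  {C of Bimod_isBimodAlg A C & Bimod A C}.

Notation "x \bm y" := (bmul x y) (at level 40, left associativity) : ring_scope.

Section BimodAlgTheory.
Variables (A : nzRingType) (C : bimodAlgType A).
Implicit Types x y : C.

Lemma bmul0l x : 0 \bm x = 0.
Proof. by apply: (@addrI _ (0 \bm x)); rewrite -bmulDl !addr0. Qed.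
Lemma bmul0r x : x \bm 0 = 0.
Proof. by apply: (@addrI _ (x \bm 0)); rewrite -bmulDr !addr0. Qed.
Lemma bmulNl x y : (- x) \bm y = - (x \bm y).
Proof. by apply/eqP; rewrite -addr_eq0 -bmulDl addNr bmul0l. Qed.
Lemma bmulNr x y : x \bm (- y) = - (x \bm y).
Proof. by apply/eqP; rewrite -addr_eq0 -bmulDr addNr bmul0r. Qed.
End BimodAlgTheory.

Section TensorPower.
Variables (A : nzRingType) (M : bimodType A).

Fixpoint tpow (k : nat) : bimodType A :=
  if k is k'.+1 then btens M (tpow k') else A^o.

Fixpoint tcat (i j : nat) : tpow i -> tpow j -> tpow (i + j) :=
  match i with
  | 0%N => fun a y => (a : A) *: y
  | i'.+1 => fun x y => tlift (fun m x' => m \ot tcat x' y) x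
  end.

Definition tensor_alg := dsum tpow.
HB.instance Definition _ := Bimod.on tensor_alg.

Let tcat_spec i : forall j,
  [/\ forall (x x' : tpow i) (y : tpow j), tcat (x + x') y = tcat x y + tcat x' y,
      forall (x : tpow i) (y y' : tpow j), tcat x (y + y') = tcat x y + tcat x y',
      forall a (x : tpow i) (y : tpow j), tcat (a *: x) y = a *: tcat x y,
      forall (x : tpow i) (y : tpow j) a, tcat x (y :* a) = tcat x y :* a &
      forall (x : tpow i) a (y : tpow j), tcat (x :* a) y = tcat x (a *: y)].
Proof.
elim: i => [|i IHi] j.
  split=> /=.
  - by move=> x x' y; exact: scalerDl.
  - by move=> x y y'; exact: scalerDr.
  - by move=> a x y; exact: (esym (scalerA _ _ _)).
  - by move=> x y a; exact: (esym (ractZ _ _ _)).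
  - by move=> x a y; exact: (esym (scalerA _ _ _)).
have {IHi} [hDl hDr hZ hR hb] := IHi j.
have bal (y : tpow j) : balanced (fun (m : M) (x' : tpow i) => m \ot tcat x' y).
  split=> [m m' x|m x x'|m a x]; first exact: pureDl.
    by rewrite hDl pureDr.
  by rewrite hZ pure_bal.
have catD (y : tpow j) := tliftD (bal y); have cat0 (y : tpow j) := tlift0 (bal y).
have catE (y : tpow j) := tlift_pure (bal y).
split=> /=.
- by move=> x x' y; exact: catD.
- move=> x y y'; elim/tens_ind: x => [|m x t IH]; first by rewrite !cat0 addr0.
  by rewrite !catD IH !catE hDr pureDr addrACA.
- move=> a x y; elim/tens_ind: x => [|m x t IH]; first by rewrite scaler0 !cat0 scaler0.
  by rewrite scalerDr !catD IH pureZ !catE scalerDr pureZ.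
- move=> x y a; elim/tens_ind: x => [|m x t IH]; first by rewrite !cat0 ract0l.
  by rewrite !catD IH !catE hR ractDl pureR.
- move=> x a y; elim/tens_ind: x => [|m x t IH]; first by rewrite ract0l !cat0.
  by rewrite ractDl !catD IH pureR !catE hb.
Qed.

Lemma tcatDl i j (x x' : tpow i) (y : tpow j) : tcat (x + x') y = tcat x y + tcat x' y.
Proof. by have [h _ _ _ _] := tcat_spec i j. Qed.
Lemma tcatDr i j (x : tpow i) (y y' : tpow j) : tcat x (y + y') = tcat x y + tcat x y'.
Proof. by have [_ h _ _ _] := tcat_spec i j. Qed.
Lemma tcatZ i j a (x : tpow i) (y : tpow j) : tcat (a *: x) y = a *: tcat x y.
Proof. by have [_ _ h _ _] := tcat_spec i j. Qed.
Lemma tcatR i j (x : tpow i) (y : tpow j) a : tcat x (y :* a) = tcat x y :* a.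
Proof. by have [_ _ _ h _] := tcat_spec i j. Qed.
Lemma tcat_bal i j (x : tpow i) a (y : tpow j) : tcat (x :* a) y = tcat x (a *: y).
Proof. by have [_ _ _ _ h] := tcat_spec i j. Qed.

Lemma tcat_balanced i j (y : tpow j) :
  balanced (fun (m : M) (x : tpow i) => m \ot tcat x y).
Proof.
split=> [m m' x|m x x'|m a x]; first exact: pureDl.
  by rewrite tcatDl pureDr.
by rewrite tcatZ pure_bal.
Qed.

Lemma tcatS i j (m : M) (x : tpow i) (y : tpow j) :
  tcat (m \ot x : tpow i.+1) y = m \ot tcat x y.
Proof. by rewrite /= (tlift_pure (tcat_balanced i y)). Qed.

Lemma tcat0l i j (y : tpow j) : tcat (0 : tpow i) y = 0.
Proof. by apply: (@addrI _ (tcat (0 : tpow i) y)); rewrite -tcatDl !addr0. Qed.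

Definition tmul (x y : tensor_alg) : tensor_alg :=
  dlift (fun i u => dlift (fun j v => dinj (tcat u v) : tensor_alg) y) x.
Definition tone : tensor_alg := dinj (1 : tpow 0).

Local Notation inj u := (dinj u : tensor_alg).

Let tmulr_add i (u : tpow i) j : {morph (fun v : tpow j => inj (tcat u v)) : v w / v + w}.
Proof. by move=> v w; rewrite tcatDr dinjD. Qed.

Let tmull_add (y : tensor_alg) i :
  {morph (fun u : tpow i => dlift (fun j v => inj (tcat u v)) y) : u w / u + w}.
Proof.
move=> u w; elim/dsum_ind: y => [|j v y IH]; first by rewrite !dlift0 ?addr0.
rewrite !dliftD // !dlift_dinj // IH; rewrite addrACA; congr (_ + _).
by rewrite tcatDl dinjD.
Qed.

Lemma tmulDl : left_distributive tmul +%R.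
Proof. by move=> x y z; rewrite /tmul dliftD //; exact: tmull_add. Qed.

Lemma tmul0l x : tmul 0 x = 0.
Proof. by apply: (@addrI _ (tmul 0 x)); rewrite -tmulDl !addr0. Qed.

Lemma tmulDr : right_distributive tmul +%R.
Proof.
move=> x y z; elim/dsum_ind: x => [|i u x IH]; first by rewrite !tmul0l addr0.
rewrite !tmulDl IH addrACA; congr (_ + _).
by rewrite /tmul !(dlift_dinj (tmull_add _)) (dliftD (@tmulr_add _ _)).
Qed.

Lemma tmul_dinj i j (u : tpow i) (v : tpow j) : tmul (inj u) (inj v) = inj (tcat u v).
Proof. by rewrite /tmul dlift_dinj ?dlift_dinj //; exact: tmull_add. Qed.

Lemma tmul0r x : tmul x 0 = 0.
Proof. by apply: (@addrI _ (tmul x 0)); rewrite -tmulDr !addr0. Qed.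

Let shift (m : M) : tensor_alg -> tensor_alg :=
  dlift (fun k (x : tpow k) => inj (m \ot x : tpow k.+1)).
Let shift_add (m : M) k : {morph (fun x : tpow k => inj (m \ot x : tpow k.+1)) : x y / x + y}.
Proof. by move=> x y; rewrite pureDr -dinjD. Qed.
Let shift_inj m k (x : tpow k) : shift m (inj x) = inj (m \ot x : tpow k.+1).
Proof. by rewrite /shift dlift_dinj //; exact: shift_add. Qed.

Let tcatA_inj i j k (x : tpow i) (y : tpow j) (z : tpow k) :
  inj (tcat x (tcat y z)) = inj (tcat (tcat x y) z).
Proof.
elim: i x => [|i IHi] x; first by rewrite /= tcatZ.
elim/tens_ind: x => [|m x t IH]; first by rewrite !tcat0l !dinj0.
rewrite !tcatDl !dinjD IH; congr (_ + _).
by rewrite !tcatS -shift_inj IHi shift_inj.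
Qed.

Lemma tmulA : associative tmul.
Proof.
move=> x y z; elim/dsum_ind: x => [|i u x IHx]; first by rewrite !tmul0l.
rewrite !tmulDl IHx; congr (_ + _) => {x IHx}.
elim/dsum_ind: y => [|j v y IHy]; first by rewrite !(tmul0l, tmul0r).
rewrite !(tmulDl, tmulDr) IHy; congr (_ + _) => {y IHy}.
elim/dsum_ind: z => [|k w z IHz]; first by rewrite !(tmul0l, tmul0r).
by rewrite !(tmulDl, tmulDr) IHz; congr (_ + _); rewrite !tmul_dinj tcatA_inj.
Qed.

Lemma tmul1l : left_id tone tmul.
Proof.
move=> y; elim/dsum_ind: y => [|j v y IH]; first by rewrite tmul0r.
by rewrite tmulDr IH tmul_dinj; congr (inj _ + _); exact: scale1r.
Qed.

Lemma tmul1r : right_id tone tmul.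
Proof.
move=> x; elim/dsum_ind: x => [|i u x IH]; first by rewrite tmul0l.
rewrite tmulDl IH tmul_dinj; congr (_ + _) => {x IH}.
elim: i u => [|i IHi] u; first by congr (inj _); exact: mulr1.
elim/tens_ind: u => [|m x t IH]; first by rewrite tcat0l !dinj0.
rewrite tcatDl !dinjD IH; congr (_ + _).
by rewrite !tcatS -shift_inj IHi shift_inj.
Qed.

Let tmulZ a (x y : tensor_alg) : tmul (a *: x) y = a *: tmul x y.
Proof.
elim/dsum_ind: x => [|i u x IHx]; first by rewrite !(scaler0, tmul0l).
rewrite !(scalerDr, tmulDl) IHx; congr (_ + _) => {x IHx}.
elim/dsum_ind: y => [|j v y IHy]; first by rewrite !(scaler0, tmul0r).
rewrite !(scalerDr, tmulDr) IHy; congr (_ + _).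
by rewrite -dinjZ !tmul_dinj tcatZ -dinjZ.
Qed.

Let tmulR (x y : tensor_alg) a : tmul x (y :* a) = tmul x y :* a.
Proof.
elim/dsum_ind: x => [|i u x IHx]; first by rewrite !(ract0l, tmul0l).
rewrite !(ractDl, tmulDl) IHx; congr (_ + _) => {x IHx}.
elim/dsum_ind: y => [|j v y IHy]; first by rewrite !(ract0l, tmul0r).
rewrite !(ractDl, tmulDr) IHy; congr (_ + _).
by rewrite -dinjR !tmul_dinj tcatR -dinjR.
Qed.

Let tmul_bal (x : tensor_alg) a (y : tensor_alg) : tmul (x :* a) y = tmul x (a *: y).
Proof.
elim/dsum_ind: x => [|i u x IHx]; first by rewrite !(ract0l, tmul0l).
rewrite !(ractDl, tmulDl) IHx; congr (_ + _) => {x IHx}.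
elim/dsum_ind: y => [|j v y IHy]; first by rewrite !(scaler0, tmul0r).
rewrite !(scalerDr, tmulDr) IHy; congr (_ + _).
by rewrite -dinjR -dinjZ !tmul_dinj tcat_bal.
Qed.

HB.instance Definition _ := Bimod_isBimodAlg.Build A tensor_alg
  tmulA tmul1l tmul1r tmulDl tmulDr tmulZ tmulR tmul_bal.

Lemma mul_dinj i j (u : tpow i) (v : tpow j) : inj u \bm inj v = inj (tcat u v).
Proof. exact: tmul_dinj. Qed.
End TensorPower.

HB.mixin Record isActClosed (A : nzRingType) (M : bimodType A) (S : {pred M}) := {
  lactClosed : forall a (x : M), x \in S -> a *: x \in S;
  ractClosed : forall a (x : M), x \in S -> x :* a \in S
}.

#[short(type="bimodClosed")]
HB.structure Definition BimodClosed (A : nzRingType) (M : bimodType A) :=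
  {S of isActClosed A M S & GRing.ZmodClosed M S}.

Section BimodQuotient.
Variables (A : nzRingType) (M : bimodType A) (S : bimodClosed M).

Definition bquot : Type := Quotient.quot S.
HB.instance Definition _ := Choice.on bquot.
HB.instance Definition _ := EqQuotient.on bquot.
HB.instance Definition _ := GRing.Zmodule.on bquot.

Definition bproj (x : M) : bquot := \pi_(Quotient.quot S) x.

Lemma bprojP x y : x - y \in S <-> bproj x = bproj y.
Proof. by rewrite Quotient.idealrBE; split=> /eqP. Qed.

Lemma bprojD : {morph bproj : x y / x + y}.
Proof. exact: (raddfD (\pi_(Quotient.quot S))). Qed.

Lemma bproj_surj (x : bquot) : exists y, bproj y = x.
Proof. by exists (repr (x : Quotient.quot S)); exact: reprK. Qed.

Let brepr (x : bquot) : M := repr (x : Quotient.quot S).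
Let breprP x : brepr (bproj x) - x \in S.
Proof. by apply/bprojP; exact: reprK. Qed.

Definition bquot_lact (a : A) (x : bquot) : bquot := bproj (a *: brepr x).
Definition bquot_ract (x : bquot) (a : A) : bquot := bproj (brepr x :* a).

Let lactE a x : bquot_lact a (bproj x) = bproj (a *: x).
Proof. by apply/bprojP; rewrite -scalerBr; apply: lactClosed; exact: breprP. Qed.
Let ractE a x : bquot_ract (bproj x) a = bproj (x :* a).
Proof. by apply/bprojP; rewrite -ractNl -ractDl; apply: ractClosed; exact: breprP. Qed.

Let qlactA a b x : bquot_lact a (bquot_lact b x) = bquot_lact (a * b) x.
Proof. by have [y <-] := bproj_surj x; rewrite !lactE scalerA. Qed.
Let qlact1 : left_id 1 bquot_lact.
Proof. by move=> x; have [y <-] := bproj_surj x; rewrite !lactE scale1r. Qed.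
Let qlactDr : right_distributive bquot_lact +%R.
Proof.
move=> a x x'; have [y <-] := bproj_surj x; have [y' <-] := bproj_surj x'.
by rewrite -bprojD !lactE scalerDr bprojD.
Qed.
Let qlactDl x : {morph bquot_lact^~ x : a b / a + b}.
Proof.
by move=> a b; have [y <-] := bproj_surj x; rewrite !lactE scalerDl bprojD.
Qed.
HB.instance Definition _ :=
  GRing.Zmodule_isLmodule.Build A bquot qlactA qlact1 qlactDr qlactDl.

Let qractDl a : {morph bquot_ract^~ a : x y / x + y}.
Proof.
move=> x x'; have [y <-] := bproj_surj x; have [y' <-] := bproj_surj x'.
by rewrite -bprojD !ractE ractDl bprojD.
Qed.
Let qractDr x : {morph bquot_ract x : a b / a + b}.
Proof.
by move=> a b; have [y <-] := bproj_surj x; rewrite !ractE ractDr bprojD.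
Qed.
Let qract1 x : bquot_ract x 1 = x.
Proof. by have [y <-] := bproj_surj x; rewrite ractE ract1. Qed.
Let qractA x a b : bquot_ract (bquot_ract x a) b = bquot_ract x (a * b).
Proof. by have [y <-] := bproj_surj x; rewrite !ractE ractA. Qed.
Let qractZ a x b : bquot_ract (a *: x) b = a *: bquot_ract x b.
Proof.
change (bquot_ract (bquot_lact a x) b = bquot_lact a (bquot_ract x b)).
by have [y <-] := bproj_surj x; rewrite lactE !ractE lactE ractZ.
Qed.
HB.instance Definition _ :=
  Lmodule_isBimod.Build A bquot qractDl qractDr qract1 qractA qractZ.

Lemma bproj_hom : bimod_hom bproj.
Proof.
split=> [|a x|a x]; first exact: bprojD.
  by rewrite -lactE.
by rewrite -ractE.
Qed.
End BimodQuotient.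

Section SubBimodGen.
Variables (A : nzRingType) (M : bimodType A) (P : M -> Prop).

Inductive bspan_spec : M -> Prop :=
| bspan_in x : P x -> bspan_spec x
| bspan_0 : bspan_spec 0
| bspan_D x y : bspan_spec x -> bspan_spec y -> bspan_spec (x + y)
| bspan_Z a x : bspan_spec x -> bspan_spec (a *: x)
| bspan_R a x : bspan_spec x -> bspan_spec (x :* a).

Definition bspan : {pred M} := fun x => `[< bspan_spec x >].

Let bspan_zmod : zmod_closed bspan.
Proof.
split=> [|x y]; rewrite !unfold_in; first by apply/asboolP; exact: bspan_0.
move=> /asboolP hx /asboolP hy; apply/asboolP; apply: bspan_D => //.
by rewrite -scaleN1r; exact: bspan_Z.
Qed.
HB.instance Definition _ := GRing.isZmodClosed.Build M bspan bspan_zmod.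

Let bspan_lact a x : x \in bspan -> a *: x \in bspan.
Proof. by rewrite !unfold_in => /asboolP h; apply/asboolP; exact: bspan_Z. Qed.
Let bspan_ract a x : x \in bspan -> x :* a \in bspan.
Proof. by rewrite !unfold_in => /asboolP h; apply/asboolP; exact: bspan_R. Qed.
HB.instance Definition _ := isActClosed.Build A M bspan bspan_lact bspan_ract.
End SubBimodGen.

Section IdealGen.
Variables (A : nzRingType) (C : bimodAlgType A) (P : C -> Prop).

Inductive ideal_spec : C -> Prop :=
| ideal_in x : P x -> ideal_spec x
| ideal_0 : ideal_spec 0
| ideal_D x y : ideal_spec x -> ideal_spec y -> ideal_spec (x + y)
| ideal_l x y : ideal_spec y -> ideal_spec (x \bm y)
| ideal_r x y : ideal_spec x -> ideal_spec (x \bm y).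

Definition ideal_gen : {pred C} := fun x => `[< ideal_spec x >].

Let ideal_zmod : zmod_closed ideal_gen.
Proof.
split=> [|x y]; rewrite !unfold_in; first by apply/asboolP; exact: ideal_0.
move=> /asboolP hx /asboolP hy; apply/asboolP; apply: ideal_D => //.
by rewrite -[y]bmul1l -bmulNl; exact: ideal_l.
Qed.
HB.instance Definition _ := GRing.isZmodClosed.Build C ideal_gen ideal_zmod.

Lemma ideal_gen_l x y : y \in ideal_gen -> x \bm y \in ideal_gen.
Proof. by rewrite !unfold_in => /asboolP h; apply/asboolP; exact: ideal_l. Qed.
Lemma ideal_gen_r x y : x \in ideal_gen -> x \bm y \in ideal_gen.
Proof. by rewrite !unfold_in => /asboolP h; apply/asboolP; exact: ideal_r. Qed.

Let ideal_lact a x : x \in ideal_gen -> a *: x \in ideal_gen.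
Proof. by move=> h; rewrite -[x]bmul1l -bmulZ; exact: ideal_gen_l. Qed.
Let ideal_ract a x : x \in ideal_gen -> x :* a \in ideal_gen.
Proof. by move=> h; rewrite -[x]bmul1r -bmulR; exact: ideal_gen_r. Qed.
HB.instance Definition _ := isActClosed.Build A C ideal_gen ideal_lact ideal_ract.

Definition algquot : Type := bquot ideal_gen.
HB.instance Definition _ := Bimod.on algquot.

Definition aproj (x : C) : algquot := bproj ideal_gen x.
Let arepr (x : algquot) : C := repr (x : Quotient.quot ideal_gen).
Let aprojK x : aproj (arepr x) = x. Proof. exact: reprK. Qed.
Let aprojD : {morph aproj : x y / x + y}. Proof. exact: bprojD. Qed.

Definition algquot_mul (x y : algquot) : algquot := aproj (arepr x \bm arepr y).

Let mulE x y : algquot_mul (aproj x) (aproj y) = aproj (x \bm y).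
Proof.
have h z : arepr (aproj z) - z \in ideal_gen by apply/bprojP; exact: aprojK.
apply/bprojP; set x' := arepr _; set y' := arepr _.
have -> : x' \bm y' - x \bm y = (x' - x) \bm y' + x \bm (y' - y).
  by rewrite bmulDl bmulNl bmulDr bmulNr addrA subrK.
by rewrite rpredD //; [apply: ideal_gen_r|apply: ideal_gen_l]; exact: h.
Qed.

Let amulA : associative algquot_mul.
Proof. by move=> x y z; rewrite -[x]aprojK -[y]aprojK -[z]aprojK !mulE bmulA. Qed.
Let amul1 : left_id (aproj (bone : C)) algquot_mul.
Proof. by move=> x; rewrite -[x]aprojK !mulE bmul1l. Qed.
Let amulr1 : right_id (aproj (bone : C)) algquot_mul.
Proof. by move=> x; rewrite -[x]aprojK !mulE bmul1r. Qed.
Let amulDl : left_distributive algquot_mul +%R.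
Proof.
by move=> x y z; rewrite -[x]aprojK -[y]aprojK -[z]aprojK -aprojD !mulE bmulDl aprojD.
Qed.
Let amulDr : right_distributive algquot_mul +%R.
Proof.
by move=> x y z; rewrite -[x]aprojK -[y]aprojK -[z]aprojK -aprojD !mulE bmulDr aprojD.
Qed.
Let aprojM' : {morph aproj : x y / x \bm y >-> algquot_mul x y}.
Proof. by move=> x y; rewrite -mulE. Qed.

Let aprojZ a x : aproj (a *: x) = a *: aproj x.
Proof. by have [_ h _] := bproj_hom ideal_gen; exact: h. Qed.
Let aprojR a x : aproj (x :* a) = aproj x :* a.
Proof. by have [_ _ h] := bproj_hom ideal_gen; exact: h. Qed.

Let abmulZ a (x y : algquot) : algquot_mul (a *: x) y = a *: algquot_mul x y.
Proof. by rewrite -[x]aprojK -[y]aprojK -aprojZ -!aprojM' bmulZ aprojZ. Qed.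
Let abmulR (x y : algquot) a : algquot_mul x (y :* a) = algquot_mul x y :* a.
Proof. by rewrite -[x]aprojK -[y]aprojK -aprojR -!aprojM' bmulR aprojR. Qed.
Let abmul_bal (x : algquot) a (y : algquot) : algquot_mul (x :* a) y = algquot_mul x (a *: y).
Proof. by rewrite -[x]aprojK -[y]aprojK -aprojR -aprojZ -!aprojM' bmul_bal. Qed.
HB.instance Definition _ :=
  Bimod_isBimodAlg.Build A algquot
  amulA amul1 amulr1 amulDl amulDr abmulZ abmulR abmul_bal.
Lemma aprojM : {morph aproj : x y / x \bm y}.
Proof. exact: aprojM'. Qed.
Lemma aproj1 : aproj bone = bone. Proof. by []. Qed.
End IdealGen.

Section Legs.
Variables (A : nzRingType).

Definition leg12 (M N M' N' P : bimodType A) (f : btens M N -> btens M' N')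
    (t : btens M (btens N P)) : btens M' (btens N' P) :=
  tassoc (tmap f id (tassocV t)).

Definition leg23 (P M N M' N' : bimodType A) (f : btens M N -> btens M' N') :
    btens P (btens M N) -> btens P (btens M' N') :=
  tmap id f.

Definition form12 (M N P : bimodType A) (g : btens M N -> A^o)
    (t : btens M (btens N P)) : P :=
  tlift (fun u (z : P) => (g u : A) *: z) (tassocV t).

Definition form23 (M N P : bimodType A) (g : btens M N -> A^o) :
    btens P (btens M N) -> P :=
  tlift (fun (z : P) u => z :* (g u : A)).
End Legs.

Section Antisymmetrizer.
Variables (A : nzRingType) (G : bimodType A) (sigma : btens G G -> btens G G).

(* sigma applied to the tensor factors i and i.+1, counted from 0 *)
Fixpoint braid_at (i k : nat) : tpow G k -> tpow G k :=
  match i, k with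
  | 0%N, k'.+2 => @leg12 A G G G G (tpow G k') sigma
  | i'.+1, k'.+1 => tmap id (@braid_at i' k')
  | _, _ => id
  end.

Fact adj_subproof k (i : 'I_k.-1) : (i.+1 < k)%N.
Proof. by rewrite -ltn_predRL. Qed.

Definition adj_tperm k (i : 'I_k.-1) : 'S_k :=
  tperm (widen_ord (leq_pred k) i) (Ordinal (adj_subproof i)).

Definition perm_length k (w : 'S_k) : nat :=
  #|[set p : 'I_k * 'I_k | (p.1 < p.2)%N && (w p.2 < w p.1)%N]|.

(* sigma_{i_1} o ... o sigma_{i_l} for a reduced decomposition
   w = s_{i_1} o ... o s_{i_l}; the choice of the decomposition does not matter
   when sigma satisfies the braid relation. The product of 'S_k is composition
   in the opposite order, whence the rev. *)
Definition braid_perm k (w : 'S_k) : tpow G k -> tpow G k :=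
  if [pick t : (perm_length w).-tuple 'I_k.-1
        | (\prod_(i <- rev t) adj_tperm i == w)%g] is Some t
  then foldr (fun (i : 'I_k.-1) f => @braid_at i k \o f) id t
  else id.

Definition antisym k (x : tpow G k) : tpow G k :=
  \sum_(w : 'S_k) ((-1) ^+ perm_length w : A) *: braid_perm w x.

Definition ext_pow (k : nat) : bimodType A := bquot (bspan (fun x => @antisym k x = 0)).
Definition ext_alg := dsum ext_pow.
HB.instance Definition _ := Bimod.on ext_alg.

Definition ext_proj : tensor_alg G -> ext_alg :=
  dlift (fun k x => dinj (bproj _ x : ext_pow k) : ext_alg).
End Antisymmetrizer.

Section Clifford.
Variables (A : nzRingType) (G : bimodType A).
Variables (sigma : btens G G -> btens G G) (g : btens G G -> A^o).

(* The identification of G (x) G with tpow G 2 = G (x) (G (x) A) *)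
Definition tpow2_of : btens G G -> tpow G 2 := tmap id (fun x : G => x \ot (1 : A^o)).

Definition clifford_rel (x : tensor_alg G) : Prop :=
  exists2 t : btens G G, sigma t = t &
    x = (dinj (tpow2_of t) : tensor_alg G) - dinj (g t : tpow G 0).

Definition clifford := algquot clifford_rel.
HB.instance Definition _ := BimodAlg.on clifford.

Definition clifford_proj : tensor_alg G -> clifford := aproj clifford_rel.
End Clifford.

Section Hopf.
Variables (R : realType) (A : algType R[i]).

Local Notation "M \tensC N" := (btens (cbim M) (cbim N)) (at level 40).
Local Notation "x \otC[ M ] y" := (@pure R[i] (cbim A^o) (cbim M) x y)
  (at level 40, format "x  \otC[ M ]  y").

(* (a (x) b)(a' (x) m) = a a' (x) b m *)
Definition tens_act (M : lmodType A) (s : A^o \tensC A^o) (t : A^o \tensC M) :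
    A^o \tensC M :=
  tlift (fun (a b : cbim A^o) =>
    tlift (fun (a' : cbim A^o) (m : cbim M) =>
      ((a : A) * (a' : A)) \otC[M] ((b : A) *: (m : M))) t) s.

(* sweedler f (cop a) is f(a_(1), a_(2)). *)
Definition sweedler (V : zmodType) (f : A -> A -> V) (t : A^o \tensC A^o) : V :=
  @tlift R[i] (cbim A^o) (cbim A^o) V f t.

Record hopf_star_alg := HopfStarAlg {
  cop : A -> A^o \tensC A^o;
  coun : A -> R[i];
  antip : A -> A;
  star : A -> A;
  cop_linear : linear cop;
  cop1 : cop 1 = (1 : A) \otC[A^o] (1 : A);
  copM : forall a b, cop (a * b) = tens_act (cop a) (cop b);
  cop_coassoc : forall a,
    tassoc (tmap (cop : cbim A^o -> A^o \tensC A^o) id (cop a)) =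
    tmap id (cop : cbim A^o -> A^o \tensC A^o) (cop a);
  coun_linear : scalar coun;
  coun1 : coun 1 = 1;
  counM : forall a b, coun (a * b) = coun a * coun b;
  counl : forall a, sweedler (fun x y => coun x *: y) (cop a) = a;
  counr : forall a, sweedler (fun x y => coun y *: x) (cop a) = a;
  antip_linear : linear antip;
  antipl : forall a, sweedler (fun x y => antip x * y) (cop a) = (coun a)%:A;
  antipr : forall a, sweedler (fun x y => x * antip y) (cop a) = (coun a)%:A;
  starD : {morph star : a b / a + b};
  starZ : forall c a, star (c *: a) = c^* *: star a;
  starK : involutive star;
  starM : forall a b, star (a * b) = star b * star a;
  cop_star : forall a,
    cop (star a) = tmap (star : cbim A^o -> cbim A^o) (star : cbim A^o -> cbim A^o) (cop a)
}.

Section Cosemisimple.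
Variable H : hopf_star_alg.

Definition subcoalgebra (D : A -> Prop) : Prop :=
  [/\ D 0, forall c a b, D a -> D b -> D (c *: a + b)
    & forall a, D a -> exists2 s : seq (A * A),
        forall p, p \in s -> D p.1 /\ D p.2 &
        cop H a = \sum_(p <- s) p.1 \otC[A^o] p.2].

Definition simple_subcoalgebra (D : A -> Prop) : Prop :=
  [/\ subcoalgebra D, exists2 a, D a & a <> 0
    & forall E, subcoalgebra E -> (forall a, E a -> D a) ->
        (forall a, E a -> a = 0) \/ (forall a, D a -> E a)].

Definition cosemisimple : Prop :=
  forall a : A, exists2 s : seq A, a = \sum_(x <- s) x &
    forall x, x \in s -> exists2 D, simple_subcoalgebra D & D x.
End Cosemisimple.

(* The finite dual of A, the underlying space of the dual Hopf algebra *)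
Definition finite_dual (f : A -> R[i]) : Prop :=
  scalar f /\
  exists n (u v : 'I_n -> A -> R[i]),
    [/\ forall i, scalar (u i), forall i, scalar (v i)
      & forall a b, f (a * b) = \sum_i u i a * v i b].

(* m (x) n |-> m_(-1) n_(-1) (x) (m_(0) (x) n_(0)) *)
Definition tens_coact (M N : bimodType A)
    (dM : M -> A^o \tensC M) (dN : N -> A^o \tensC N) :
    btens M N -> A^o \tensC (btens M N) :=
  tlift (fun (m : M) (n : N) =>
    tlift (fun (a : cbim A^o) (m' : cbim M) =>
      tlift (fun (b : cbim A^o) (n' : cbim N) =>
        ((a : A) * (b : A)) \otC[btens M N] ((m' : M) \ot (n' : N))) (dN n)) (dM m)).

Record star_calculus (H : hopf_star_alg) (G : bimodType A) := StarCalculus {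
  diff : A -> G;
  coactl : G -> A^o \tensC G;
  gstar : G -> G;
  calc_central : forall (c : R[i]) (x : G), c%:A *: x = x :* c%:A;
  diff_linear : linear (diff : A -> cbim G);
  diffM : forall a b, diff (a * b) = diff a :* b + a *: diff b;
  calc_gen : forall x : G, exists s : seq (A * A), x = \sum_(p <- s) p.1 *: diff p.2;
  coactl_linear : linear (coactl : cbim G -> A^o \tensC G);
  coactl_diff : forall a b,
    coactl (a *: diff b) =
    tens_act (cop H a) (tmap id (diff : cbim A^o -> cbim G) (cop H b));
  gstarD : {morph gstar : x y / x + y};
  gstarK : involutive gstar;
  gstarZ : forall a x, gstar (a *: x) = gstar x :* star H a;
  gstarR : forall a x, gstar (x :* a) = star H a *: gstar x;
  gstar_diff : forall a, gstar (diff a) = diff (star H a)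
}.

Section Calculus.
Variables (H : hopf_star_alg) (G : bimodType A) (calc : star_calculus H G).
Local Notation d := (diff calc).
Local Notation S := (antip H).

Definition left_inv (x : G) : Prop := coactl calc x = (1 : A) \otC[G] x.

(* omega(a) = S(a_(1)) d a_(2) *)
Definition mc_form (a : A) : G := sweedler (fun x y => S x *: d y) (cop H a).

Definition calc_ideal (b : A) : Prop := mc_form b = 0 /\ coun H b = 0.

(* theta is a basis of the space of left-invariant forms, and X is the dual basis
   of the quantum tangent space. *)
Record tangent_basis n (theta : 'I_n -> G) (X : 'I_n -> A -> R[i]) : Prop :=
  TangentBasis {
  theta_inv : forall i, left_inv (theta i);
  theta_span : forall x, left_inv x ->
    exists c : 'I_n -> R[i], x = \sum_i (c i)%:A *: theta i;
  theta_free : forall c : 'I_n -> R[i],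
    \sum_i (c i)%:A *: theta i = 0 -> forall i, c i = 0;
  X_dual : forall i, finite_dual (X i);
  diffE : forall a,
    d a = \sum_i (sweedler (fun x y => X i y *: x) (cop H a) : A) *: theta i
}.

Definition tangent_space n (X : 'I_n -> A -> R[i]) (f : A -> R[i]) : Prop :=
  exists c : 'I_n -> R[i], forall a, f a = \sum_i c i * X i a.

(* The antipode of the dual Hopf algebra is f |-> f o S. *)
Definition S2_invariant n (X : 'I_n -> A -> R[i]) : Prop :=
  forall f : A -> R[i], tangent_space X f <->
    exists2 h, tangent_space X h & forall a, f a = h (S (S a)).

Record is_S2 n (theta : 'I_n -> G) (X : 'I_n -> A -> R[i])
    (F : 'M[R[i]]_n) (s2 : G -> G) : Prop := IsS2 {
  S2_X : forall i a, X i (S (S a)) = \sum_j F i j * X j a;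
  S2_theta : forall i, s2 (theta i) = \sum_j (F j i)%:A *: theta j;
  S2_D : {morph s2 : x y / x + y};
  S2_Z : forall a x, s2 (a *: x) = S (S a) *: s2 x
}.

(* A sign in the definition of the involution would not affect its uses below. *)
Definition gstar2 : btens G G -> btens G G :=
  tlift (fun x y => gstar calc y \ot gstar calc x).

Definition coactl2 : btens G G -> A^o \tensC (btens G G) :=
  tens_coact (coactl calc) (coactl calc).

Record is_braiding (s2 : G -> G) (sigma sigmaV : btens G G -> btens G G) : Prop :=
  IsBraiding {
  sigma_hom : bimod_hom sigma;
  sigmaK : cancel sigma sigmaV;
  sigmaVK : cancel sigmaV sigma;
  sigma_coact : forall t, coactl2 (sigma t) =
    tmap id (sigma : cbim (btens G G) -> cbim (btens G G)) (coactl2 t);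
  sigma_braid : forall t : btens G (btens G G),
    leg12 sigma (leg23 sigma (leg12 sigma t)) =
    leg23 sigma (leg12 sigma (leg23 sigma t));
  sigma_ideal : forall a, calc_ideal a ->
    let t := sweedler (fun x y => mc_form x \ot mc_form y) (cop H a) in sigma t = t;
  sigma_S2 : forall t, sigma (tmap s2 s2 t) = tmap s2 s2 (sigma t);
  sigma_star : (forall t, gstar2 (sigma t) = sigma (gstar2 t)) \/
               (forall t, gstar2 (sigma t) = sigmaV (gstar2 t))
}.

Record is_sigma_metric (s2 : G -> G) (sigma sigmaV : btens G G -> btens G G)
    (g : btens G G -> A^o) : Prop := IsSigmaMetric {
  metric_hom : bimod_hom g;
  metric_coact : forall t, cop H (g t) =
    tmap id (g : cbim (btens G G) -> cbim A^o) (coactl2 t);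
  metric_nondegl : forall x, (forall y, g (x \ot y) = 0) -> x = 0;
  metric_nondegr : forall y, (forall x, g (x \ot y) = 0) -> y = 0;
  metric_sigma : forall t, g (sigma t) = g t;
  metric_braid : forall t : btens G (btens G G),
    form12 g (leg23 sigma (leg12 sigma t)) = form23 g t;
  metric_braidV : forall t : btens G (btens G G),
    form12 g (leg23 sigmaV (leg12 sigmaV t)) = form23 g t;
  metric_star : forall x y,
    star H (g (x \ot y)) = g (gstar calc y \ot gstar calc x);
  metric_S2 : forall x y, left_inv x -> left_inv y -> g (s2 y \ot x) = g (x \ot y)
}.

Record left_connection (C : bimodType A) (nabla : C -> btens G C) : Prop :=
  LeftConnection {
  conn_linear : linear (nabla : cbim C -> cbim (btens G C));
  conn_leibniz : forall a x, nabla (a *: x) = d a \ot x + a *: nabla x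
}.

Record linear_left_connection (C : bimodType A) (nabla : C -> btens G C)
    (tau : btens C G -> btens G C) : Prop := LinearLeftConnection {
  lconn_left : left_connection nabla;
  lconn_hom : bimod_hom tau;
  lconn_tau : forall x a, tau (x \ot d a) = nabla (x :* a) - nabla x :* a
}.

Record alg_left_connection (C : bimodAlgType A) (nabla : C -> btens G C)
    (tau : btens C G -> btens G C) : Prop := AlgLeftConnection {
  aconn_linear : linear_left_connection nabla tau;
  aconn_mul : forall x y : C, nabla (x \bm y) =
    tmap id (tlift (fun u v : C => u \bm v))
      (tassoc (nabla x \ot y) + leg12 tau (x \ot nabla y))
}.

(* tpow G 1 = G (x) A is identified with G, so that nabla itself is extended. *)
Fixpoint conn_pow (nabla : G -> btens G G) (tau : btens G G -> btens G G) (k : nat) :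
    tpow G k -> btens G (tpow G k) :=
  match k with
  | 0%N => fun a => d a \ot (1 : A^o)
  | k'.+1 => tlift (fun (x : G) (u : tpow G k') =>
      tassoc (nabla x \ot u) + leg12 tau (x \ot conn_pow nabla tau u))
  end.

Definition conn_alg (nabla : G -> btens G G) (tau : btens G G -> btens G G) :
    tensor_alg G -> btens G (tensor_alg G) :=
  dlift (fun k u =>
    tmap id (fun v : tpow G k => dinj v : tensor_alg G) (conn_pow nabla tau u)).
End Calculus.
End Hopf.

(* Main.v *)
Require Import Defs.
From HB Require Import structures.
From mathcomp Require Import all_boot all_order all_algebra perm ring_quotient.
From mathcomp Require Import boolp reals complex.

Set Implicit Arguments.
Unset Strict Implicit.
Unset Printing Implicit Defensive.

Import GRing.Theory.
Local Open Scope ring_scope.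

(** Write T for the braiding of the connection and move a one-form y from the right
    end of a tensor power of G to its left end by
      [pull T y x = T_12 T_23 ... T_(k,k+1) (x (x) y)].
    Because the calculus is inner, the recursive extension of the connection
    telescopes on every tensor power (conn_powE) to
      [nabla x = omega (x) x - pull T omega x].
    Hence everything is a statement about pull, the summand [omega (x) x] being
    harmless.

    The hypothesis on sigma and T says that sigma passes through T_12 T_23, so pull
    commutes with sigma acting on any two neighbouring factors, hence with the
    antisymmetrizer (pull_antisym), and so does nabla: it preserves the kernel of the
    antisymmetrizer A_k.  To descend to the quotient one needs more, namely that
    [pull T omega x] lies in G (x) ker A_k, while a priori it only lies in the kernel
    of id (x) A_k.  These two agree when G is flat as a right A-module, and in fact G
    is free on the right.  Left freeness on the invariant forms theta_i comes from the
    coaction: for a relation [sum a_i theta_i = 0] the antipode yields eps(a_i) = 0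
    (theta_coun), so [sum b_i theta_i |-> eps(b_i)] is well defined, and applied to the
    second leg of the coaction it recovers a_i (theta_free_left).  The involution of
    the calculus turns this left basis into a right one (gstar_dual_basis).

    On the tensor algebra pull is multiplicative: moving y to the left of x x' means
    moving it past x' and then past x (pull_alg_mul).  Therefore the set of x for which
    all pull y x vanish modulo the Clifford ideal is stable under multiplication from
    both sides, and only the generators t - g(t) with sigma(t) = t remain.  There
    [s = T_12 T_23 (t (x) y)] is fixed by id (x) sigma, while the second hypothesis
    gives [g_23 s = g(t) y]; by flatness s is a sum of tensors z (x) u with
    sigma(u) = u, for which u and g(u) agree in the Clifford algebra.  The descended
    pull is then the braiding of the connection on the Clifford algebra, and its
    multiplicativity is the Leibniz rule (inner_alg_connection). *)

(** * Additive maps and tensor products of homomorphisms *)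

Section AdditiveMaps.
Variables (M N : zmodType) (f : M -> N).
Hypothesis fD : {morph f : x y / x + y}.

Lemma morph0 : f 0 = 0.
Proof. by apply: (@addrI _ (f 0)); rewrite -fD !addr0. Qed.

Lemma morphN x : f (- x) = - f x.
Proof. by apply/eqP; rewrite -addr_eq0 -fD addNr morph0. Qed.

Lemma morphB x y : f (x - y) = f x - f y.
Proof. by rewrite fD morphN. Qed.

Lemma morph_sum I (r : seq I) (P : pred I) (F : I -> M) :
  f (\sum_(i <- r | P i) F i) = \sum_(i <- r | P i) f (F i).
Proof. exact: (big_morph f fD morph0). Qed.
End AdditiveMaps.

Lemma comp_morphD (M N P : zmodType) (f : N -> P) (h : M -> N) :
  {morph f : x y / x + y} -> {morph h : x y / x + y} ->
  {morph (fun x => f (h x)) : x y / x + y}.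
Proof. by move=> fD hD x y /=; rewrite hD fD. Qed.

Lemma add_morphD (M N : zmodType) (f h : M -> N) :
  {morph f : x y / x + y} -> {morph h : x y / x + y} ->
  {morph (fun x => f x + h x) : x y / x + y}.
Proof. by move=> fD hD x y; rewrite fD hD addrACA. Qed.

Lemma sub_morphD (M N : zmodType) (f h : M -> N) :
  {morph f : x y / x + y} -> {morph h : x y / x + y} ->
  {morph (fun x => f x - h x) : x y / x + y}.
Proof. by move=> fD hD x y; rewrite fD hD opprD addrACA. Qed.

Section TensorMaps.
Variable A : nzRingType.

Lemma tens_ext (M N : bimodType A) (Z : zmodType) (f h : btens M N -> Z) :
    {morph f : s t / s + t} -> {morph h : s t / s + t} ->
  (forall x y, f (x \ot y) = h (x \ot y)) -> f =1 h.
Proof.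
move=> fD hD e; elim/tens_ind=> [|x y t IH]; first by rewrite !morph0.
by rewrite fD hD e IH.
Qed.

Lemma dsum_ext (F : nat -> bimodType A) (Z : zmodType) (f h : dsum F -> Z) :
    {morph f : s t / s + t} -> {morph h : s t / s + t} ->
  (forall k (u : F k), f (dinj u) = h (dinj u)) -> f =1 h.
Proof.
move=> fD hD e; elim/dsum_ind=> [|k u x IH]; first by rewrite !morph0.
by rewrite fD hD e IH.
Qed.

(** Exactly the maps h for which id (x) h exists on a tensor product over A; the maps
    [x |-> x (x) z] below are of this kind but are not right linear. *)
Definition left_hom (M N : bimodType A) (f : M -> N) : Prop :=
  {morph f : x y / x + y} /\ forall a, {morph f : x / a *: x}.

Lemma bimod_homl (M N : bimodType A) (f : M -> N) : bimod_hom f -> left_hom f.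
Proof. by case. Qed.

Lemma left_hom_id (M : bimodType A) : left_hom (@id M).
Proof. by []. Qed.

Lemma left_hom_comp (M N P : bimodType A) (f : N -> P) (h : M -> N) :
  left_hom f -> left_hom h -> left_hom (fun x => f (h x)).
Proof.
by move=> [fD fZ] [hD hZ]; split=> [x y|a x]; rewrite ?hD ?fD // hZ fZ.
Qed.

Lemma left_hom_tail (M N : bimodType A) (y : N) : left_hom (fun x : M => x \ot y).
Proof. by split=> [x x'|a x]; [exact: pureDl|rewrite pureZ]. Qed.

Section RightFactor.
Variables (M N N' : bimodType A) (h : N -> N').
Hypothesis hh : left_hom h.

Let bal : balanced (fun (x : M) (y : N) => x \ot h y).
Proof.
have [hD hZ] := hh; split=> [x x' y|x y y'|x a y]; first exact: pureDl.
  by rewrite hD pureDr.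
by rewrite hZ pure_bal.
Qed.

Lemma tmapr_pure (x : M) (y : N) : tmap id h (x \ot y) = x \ot h y.
Proof. exact: tlift_pure bal _ _. Qed.

Lemma tmaprD : {morph tmap (@id M) h : s t / s + t}.
Proof. exact: tliftD bal. Qed.

Lemma tmapr_homl : left_hom (tmap (@id M) h).
Proof.
split=> [|a t]; first exact: tmaprD.
elim/tens_ind: t => [|x y t IH]; first by rewrite !(scaler0, morph0 tmaprD).
by rewrite scalerDr !tmaprD IH scalerDr pureZ !tmapr_pure pureZ.
Qed.

Lemma tmapr_homr a : (forall y, h (y :* a) = h y :* a) ->
  forall t, tmap (@id M) h (t :* a) = tmap id h t :* a.
Proof.
move=> hR; apply: tens_ext => [s t|s t|x y]; rewrite ?ractDl ?tmaprD ?ractDl //.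
by rewrite pureR !tmapr_pure hR pureR.
Qed.
End RightFactor.

Lemma tmapr_comp (M N N' N'' : bimodType A) (f : N' -> N'') (h : N -> N') t :
  left_hom f -> left_hom h ->
  tmap (@id M) f (tmap id h t) = tmap id (fun x => f (h x)) t.
Proof.
move=> fh hh; have fhh := left_hom_comp fh hh.
move: t; apply: tens_ext; [exact: comp_morphD (tmaprD fh) (tmaprD hh)|exact: tmaprD|].
by move=> x y; rewrite !tmapr_pure.
Qed.

Lemma eq_tmapr (M N N' : bimodType A) (f h : N -> N') t :
  f =1 h -> tmap (@id M) f t = tmap id h t.
Proof. by move=> /funext ->. Qed.

Section Associator.
Variables (M N P : bimodType A).

Let assoc_bal : balanced (fun (u : btens M N) (z : P) => tmap id (fun y => y \ot z) u).
Proof.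
have tD z := tmaprD (M := M) (left_hom_tail N z).
have tE z (x : M) := tmapr_pure (left_hom_tail N z) x.
split=> [u1 u2 z|u z1 z2|u a z]; first exact: tD.
  move: u; apply: tens_ext => [s t|s t|x y]; rewrite ?tD ?(addrACA _ _ (tmap _ _ t)) //.
  by rewrite !tE !pureDr.
move: u; apply: tens_ext => [s t|s t|x y]; rewrite ?ractDl ?tD //.
by rewrite pureR !tE pure_bal.
Qed.

(** The associator on u (x) z appends z to the second factor of u.  In this form the
    legs of a three-fold tensor product become functorial in the last factor. *)
Lemma tassoc_pure (u : btens M N) (z : P) :
  tassoc (u \ot z) = tmap id (fun y => y \ot z) u.
Proof. exact: (tlift_pure assoc_bal). Qed.

Lemma tassocD : {morph @tassoc A M N P : s t / s + t}.
Proof. exact: (tliftD assoc_bal). Qed.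

Lemma tassoc_homl : left_hom (@tassoc A M N P).
Proof.
split=> [|a]; first exact: tassocD.
apply: tens_ext => [s t|s t|u z]; rewrite ?scalerDr ?tassocD ?scalerDr //.
by rewrite pureZ !tassoc_pure (proj2 (tmapr_homl _ (left_hom_tail _ _))).
Qed.

Lemma tassoc_homr a t : tassoc (t :* a) = tassoc t :* a :> btens M (btens N P).
Proof.
move: t; apply: tens_ext => [s t|s t|u z]; rewrite ?(ractDl, tassocD) //.
rewrite pureR !tassoc_pure; move: u.
apply: tens_ext => [s t|s t|x y]; rewrite ?(tmaprD (left_hom_tail _ _)) ?ractDl //.
by rewrite !(tmapr_pure (left_hom_tail _ _)) !pureR.
Qed.

Let assocV_bal_in (x : M) : balanced (fun (y : N) (z : P) => (x \ot y) \ot z).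
Proof.
split=> [y y' z|y z z'|y a z]; first by rewrite pureDr pureDl.
  exact: pureDr.
by rewrite -pureR pure_bal.
Qed.

Let assocV_bal : balanced (fun (x : M) (u : btens N P) =>
  tlift (fun y z => (x \ot y) \ot z) u).
Proof.
have tD x := tliftD (assocV_bal_in x); have tE x := tlift_pure (assocV_bal_in x).
split=> [x x' u|x u u'|x a u]; last 1 first.
- move: u; apply: tens_ext => [s t|s t|y z]; rewrite ?scalerDr ?tD //.
  by rewrite pureZ !tE pure_bal.
- move: u; apply: tens_ext => [s t|s t|y z]; rewrite ?tD //.
    by rewrite addrACA.
  by rewrite !tE !pureDl.
- exact: tD.
Qed.

Lemma tassocV_pure (x : M) (y : N) (z : P) : tassocV (x \ot (y \ot z)) = (x \ot y) \ot z.
Proof.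
by rewrite [LHS](tlift_pure assocV_bal) (tlift_pure (assocV_bal_in x)).
Qed.

Lemma tassocVD : {morph @tassocV A M N P : s t / s + t}.
Proof. exact: (tliftD assocV_bal). Qed.

Lemma tassocV_homl : left_hom (@tassocV A M N P).
Proof.
split=> [|a]; first exact: tassocVD.
apply: tens_ext => [s t|s t|x u]; rewrite ?scalerDr ?tassocVD ?scalerDr //.
move: u; apply: tens_ext => [s t|s t|y z].
- by rewrite pureDr scalerDr tassocVD.
- by rewrite pureDr tassocVD scalerDr.
by rewrite pureZ !tassocV_pure !pureZ.
Qed.

Lemma tassocV_homr a t : tassocV (t :* a) = tassocV t :* a :> btens (btens M N) P.
Proof.
move: t; apply: tens_ext => [s t|s t|x u]; rewrite ?(ractDl, tassocVD) //.
move: u; apply: tens_ext => [s t|s t|y z].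
- by rewrite pureDr ractDl tassocVD.
- by rewrite pureDr tassocVD ractDl.
by rewrite !pureR !tassocV_pure !pureR.
Qed.
End Associator.

Section LeftFactor.
Variables (M M' P : bimodType A) (f : M -> M').
Hypothesis fh : bimod_hom f.

Let bal : balanced (fun (x : M) (y : P) => f x \ot y).
Proof.
have [fD fZ fR] := fh; split=> [x x' y|x y y'|x a y]; last by rewrite fR pure_bal.
  by rewrite fD pureDl.
exact: pureDr.
Qed.

Lemma tmapl_pure (x : M) (y : P) : tmap f id (x \ot y) = f x \ot y.
Proof. exact: (tlift_pure bal). Qed.

Lemma tmaplD : {morph tmap f (@id P) : s t / s + t}.
Proof. exact: (tliftD bal). Qed.

Lemma tmapl_homl : left_hom (tmap f (@id P)).
Proof.
have [_ fZ _] := fh; split=> [|a]; first exact: tmaplD.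
apply: tens_ext => [s t|s t|x y]; rewrite ?scalerDr ?tmaplD ?scalerDr //.
by rewrite pureZ !tmapl_pure fZ pureZ.
Qed.

Lemma tmapl_homr a t : tmap f (@id P) (t :* a) = tmap f id t :* a.
Proof.
move: t; apply: tens_ext => [s t|s t|x y]; rewrite ?(ractDl, tmaplD) //.
by rewrite pureR !tmapl_pure pureR.
Qed.
End LeftFactor.

Section Leg12.
Variables (M N M' N' : bimodType A) (f : btens M N -> btens M' N').
Hypothesis fh : bimod_hom f.

Lemma leg12_pure (P : bimodType A) (x : M) (y : N) (z : P) :
  leg12 f (x \ot (y \ot z)) = tmap id (fun v => v \ot z) (f (x \ot y)).
Proof. by rewrite /leg12 tassocV_pure tmapl_pure // tassoc_pure. Qed.

Lemma leg12_homl (P : bimodType A) : left_hom (@leg12 A M N M' N' P f).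
Proof.
apply: left_hom_comp; first exact: tassoc_homl.
by apply: left_hom_comp; [exact: tmapl_homl|exact: tassocV_homl].
Qed.

Lemma leg12_homr (P : bimodType A) a t :
  leg12 f (t :* a) = (leg12 f t :* a : btens M' (btens N' P)).
Proof. by rewrite /leg12 tassocV_homr tmapl_homr // tassoc_homr. Qed.

(** A map on the first two factors commutes with a map on the remaining ones. *)
Lemma leg12_natural (P P' : bimodType A) (h : P -> P') t : left_hom h ->
  leg12 f (tmap id (tmap id h) t) = tmap id (tmap id h) (leg12 f t).
Proof.
move=> hh; have hh1 := tmapr_homl N hh; have hh1' := tmapr_homl N' hh.
have [hh2 hh2'] := (tmapr_homl M hh1, tmapr_homl M' hh1').
have [[lD _] [lD' _]] := (leg12_homl P, leg12_homl P').
move: t; apply: tens_ext => [s t|s t|x u]; rewrite ?(proj1 hh2) ?lD' ?lD ?(proj1 hh2') //.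
rewrite tmapr_pure //; move: u; apply: tens_ext => [s t|s t|y z].
- by rewrite (proj1 hh1) pureDr lD'.
- by rewrite pureDr lD (proj1 hh2').
rewrite tmapr_pure // !leg12_pure tmapr_comp //; last exact: left_hom_tail.
by apply: eq_tmapr => v; rewrite tmapr_pure.
Qed.

Lemma leg12_tail (P : bimodType A) (z : P) t :
  leg12 f (tmap id (fun y => y \ot z) t) = tmap id (fun y => y \ot z) (f t).
Proof.
have [fD _ _] := fh; have th K := left_hom_tail K z.
move: t; apply: tens_ext => [s t|s t|x y].
- by rewrite (tmaprD (th _)) (proj1 (leg12_homl _)).
- by rewrite fD (tmaprD (th _)).
by rewrite (tmapr_pure (th _)) leg12_pure.
Qed.
End Leg12.

Lemma bimod_hom_leg12 (M N M' N' P : bimodType A) (f : btens M N -> btens M' N') :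
  bimod_hom f -> bimod_hom (@leg12 A M N M' N' P f).
Proof.
move=> fh; have [lD lZ] := leg12_homl fh P; split=> // a t; exact: leg12_homr.
Qed.

Lemma bimod_hom_leg23 (P N N' : bimodType A) (f : N -> N') :
  bimod_hom f -> bimod_hom (tmap (@id P) f).
Proof.
move=> fh; have [fD fZ fR] := fh; have [lD lZ] := tmapr_homl P (bimod_homl fh).
split=> // a t; exact: (tmapr_homr (bimod_homl fh) (fR a)).
Qed.
End TensorMaps.

(** * Moving a one-form to the front of a tensor power *)

Section Pull.
Variables (A : nzRingType) (G : bimodType A) (T : btens G G -> btens G G).
Hypothesis Th : bimod_hom T.

(** The one-form y is a fixed parameter, so that pull y is only left linear in its
    argument; pull_bal and pullR express that it comes from a bimodule map on the
    tensor product of the tensor power with G. *)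
Fixpoint pull (y : G) (k : nat) : tpow G k -> btens G (tpow G k) :=
  match k with
  | 0%N => fun a => ((a : A) *: y) \ot (1 : A^o)
  | k'.+1 => tlift (fun (m : G) (u : tpow G k') =>
      @leg12 A G G G G (tpow G k') T (m \ot pull y u))
  end.

Let legD (P : bimodType A) := proj1 (leg12_homl Th P).
Let legZ (P : bimodType A) := proj2 (leg12_homl Th P).

Let pull_spec y k : left_hom (@pull y k) /\ balanced (fun (m : G) (u : tpow G k) =>
  @leg12 A G G G G (tpow G k) T (m \ot pull y u)).
Proof.
have bal j : left_hom (@pull y j) -> balanced (fun (m : G) (u : tpow G j) =>
    @leg12 A G G G G (tpow G j) T (m \ot pull y u)).
  move=> [pD pZ]; split=> [m m' u|m u u'|m a u].
  - by rewrite pureDl legD.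
  - by rewrite pD pureDr legD.
  - by rewrite pZ pure_bal.
elim: k => [|k [ph pb]].
  have ph : left_hom (@pull y 0%N).
    split=> [a b|a b] /=; first by rewrite scalerDl pureDl.
    by rewrite pureZ scalerA.
  by split=> //; exact: bal.
have ph1 : left_hom (@pull y k.+1).
  have pD := tliftD pb; split=> [|a]; first exact: pD.
  apply: tens_ext => [s t|s t|m u] /=; rewrite ?scalerDr ?pD ?scalerDr //.
  by rewrite pureZ !(tlift_pure pb) -legZ pureZ.
by split=> //; exact: bal.
Qed.

Lemma pull_homl y k : left_hom (@pull y k).
Proof. by have [] := pull_spec y k. Qed.

Lemma pullS y k (m : G) (u : tpow G k) :
  pull y (m \ot u : tpow G k.+1) = leg12 T (m \ot pull y u).
Proof. by have [_ pb] := pull_spec y k; exact: (tlift_pure pb). Qed.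

Let pullD y k := proj1 (pull_homl y k).

Lemma pullDy k (x : tpow G k) : {morph (fun y => pull y x) : y y' / y + y'}.
Proof.
move=> y y'; elim: k x => [|k IH] x; first by rewrite /= scalerDr pureDl.
move: x; apply: tens_ext => [s t|s t|m u]; rewrite ?pullD //.
  by rewrite addrACA.
by rewrite !pullS IH pureDr legD.
Qed.

Lemma pullR y a k (x : tpow G k) : pull (y :* a) x = pull y x :* a.
Proof.
elim: k x => [|k IH] x.
  by rewrite /= -ractZ pure_bal pureR; congr (_ \ot _); rewrite [LHS]mulr1 [RHS]mul1r.
move: x; apply: tens_ext => [s t|s t|m u]; rewrite ?ractDl ?pullD ?ractDl //.
by rewrite !pullS IH -pureR leg12_homr.
Qed.

Lemma pull_bal y a k (x : tpow G k) : pull (a *: y) x = pull y (x :* a).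
Proof.
elim: k x => [|k IH] x; first by rewrite /= scalerA.
move: x; apply: tens_ext => [s t|s t|m u]; rewrite ?ractDl ?pullD //.
by rewrite pureR !pullS IH.
Qed.

Section Braiding.
Variable sigma : btens G G -> btens G G.
Hypothesis sh : bimod_hom sigma.

Lemma bimod_hom_comp (M N P : bimodType A) (f : N -> P) (h : M -> N) :
  bimod_hom f -> bimod_hom h -> bimod_hom (fun x => f (h x)).
Proof.
move=> [fD fZ fR] [hD hZ hR].
by split=> [x y|a x|a x]; rewrite ?hD ?fD // ?hZ ?fZ // hR fR.
Qed.

Lemma braid_at_hom i k : bimod_hom (@braid_at A G sigma i k).
Proof.
elim: i k => [|i IH] [|k] //=; first by case: k => [|k] //; exact: bimod_hom_leg12.
exact: bimod_hom_leg23.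
Qed.

Lemma braid_perm_hom k (w : 'S_k) : bimod_hom (@braid_perm A G sigma k w).
Proof.
rewrite /braid_perm; case: pickP => [t _|_] //.
elim: (val t) => [|i s IH] //=; exact: bimod_hom_comp (braid_at_hom i k) IH.
Qed.

Lemma antisym_hom k : bimod_hom (@antisym A G sigma k).
Proof.
rewrite /antisym; split=> [x y|a x|a x].
- rewrite -big_split; apply: eq_bigr => w _ /=.
  by have [hD _ _] := braid_perm_hom w; rewrite hD scalerDr.
- rewrite scaler_sumr; apply: eq_bigr => w _.
  by have [_ hZ _] := braid_perm_hom w; rewrite hZ !scalerA commr_sign.
- rewrite ract_sum; apply: eq_bigr => w _.
  by have [_ _ hR] := braid_perm_hom w; rewrite hR ractZ.
Qed.

Hypothesis sT : forall t : btens G (btens G G),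
  leg23 sigma (leg12 T (leg23 T t)) = leg12 T (leg23 T (leg12 sigma t)).

(** Identities between maps on three factors are transported to more factors by
    appending an arbitrary tail p. *)
Let tail (P : bimodType A) (p : P) : btens G (btens G G) -> btens G (btens G (btens G P)) :=
  tmap id (tmap id (fun y => y \ot p)).

Lemma leg23_leg12_tail f (P : bimodType A) (p : P) t : bimod_hom f ->
  tmap id (leg12 f) (tail p t) = tail p (leg23 f t).
Proof.
move=> fh; have th := left_hom_tail G p.
have lh := leg12_homl fh P; have fh' := bimod_homl fh.
rewrite /tail /leg23 !tmapr_comp //; try exact: tmapr_homl.
by apply: eq_tmapr => u; rewrite leg12_tail.
Qed.

Lemma leg12_leg12_tail f (P : bimodType A) (p : P) t : bimod_hom f ->
  leg12 f (tail p t) = tail p (leg12 f t).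
Proof. by move=> fh; rewrite leg12_natural //; exact: left_hom_tail. Qed.

Lemma tensor3_ext (P : bimodType A) (Z : zmodType)
    (f h : btens G (btens G (btens G P)) -> Z) :
    {morph f : s t / s + t} -> {morph h : s t / s + t} ->
    (forall t p, f (tail p t) = h (tail p t)) -> f =1 h.
Proof.
move=> fD hD e; apply: tens_ext => // x u; move: u.
apply: tens_ext => [s t|s t|y v]; rewrite ?pureDr ?fD ?hD //; move: v.
apply: tens_ext => [s t|s t|z p]; rewrite ?pureDr ?fD ?hD //.
have th := left_hom_tail G p; have th1 := tmapr_homl G th.
by have := e (x \ot (y \ot z)) p; rewrite /tail tmapr_pure // tmapr_pure.
Qed.

(** The hypothesis sT with further tensor factors on the right. *)
Lemma leg_exchange (P : bimodType A) (t : btens G (btens G (btens G P))) :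
  tmap id (leg12 sigma) (leg12 T (tmap id (leg12 T) t)) =
  leg12 T (tmap id (leg12 T) (leg12 sigma t)).
Proof.
have [lT ls] := (leg12_homl Th P, leg12_homl sh P).
move: t; apply: tensor3_ext => [|| t p].
- apply: comp_morphD (tmaprD ls) _.
  by apply: comp_morphD (tmaprD lT); exact: legD.
- apply: (comp_morphD (@legD _)).
  exact: (comp_morphD (tmaprD lT) (proj1 (leg12_homl sh _))).
by rewrite !(leg23_leg12_tail, leg12_leg12_tail) // sT.
Qed.

Lemma tmapr_id (M N : bimodType A) (t : btens M N) : tmap id id t = t.
Proof.
by move: t; apply: tens_ext => [|//|m u]; [exact: tmaprD|rewrite tmapr_pure].
Qed.

(** Past the two leading factors, pull acts by the composite T_12 T_23 that the
    hypothesis sT is about. *)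
Lemma pull_tail2 y k (v : tpow G k) (t : btens G G) :
  pull y (tmap id (fun n => n \ot v) t : tpow G k.+2) =
  leg12 T (tmap id (leg12 T) (tmap id (fun n => n \ot pull y v) t)).
Proof.
have lT := leg12_homl Th (tpow G k); have th (P : bimodType A) := @left_hom_tail A G P.
move: t; apply: tens_ext => [s t|s t|m n].
- by rewrite (tmaprD (th _ _)) pullD.
- by rewrite !(tmaprD (th _ _), tmaprD lT) legD.
by rewrite !(tmapr_pure (th _ _)) (tmapr_pure lT) !pullS.
Qed.

(** For i = 0 this is sT, and sigma acting on later factors is left untouched by the
    outermost T_12. *)
Lemma pull_braid_at y i k (x : tpow G k) :
  tmap id (@braid_at A G sigma i k) (pull y x) = pull y (braid_at sigma i x).
Proof.
elim: i k x => [|i IH] [|k] x; rewrite ?tmapr_id //=.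
  case: k x => [|k] x; first exact: tmapr_id.
  have lsh := leg12_homl sh (tpow G k); have [bD _] := lsh.
  have pD := @pullD y k.+2.
  move: x; apply: tens_ext => [s t|s t|m u].
  - exact: (comp_morphD (tmaprD lsh) pD).
  - exact: (comp_morphD pD bD).
  move: u; apply: tens_ext => [s t|s t|n v].
  - exact: (comp_morphD (comp_morphD (tmaprD lsh) pD) (pureDr m)).
  - exact: (comp_morphD (comp_morphD pD bD) (pureDr m)).
  have e := pull_tail2 y v (m \ot n); rewrite !(tmapr_pure (left_hom_tail _ _)) in e.
  apply: (etrans (congr1 (tmap id (leg12 sigma)) e)).
  by rewrite leg_exchange !leg12_pure // -pull_tail2.
have bh := bimod_homl (braid_at_hom i k); have bh1 := tmapr_homl G bh.
have pD := @pullD y k.+1.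
move: x; apply: tens_ext => [s t|s t|m u].
- exact: (comp_morphD (tmaprD bh1) pD).
- exact: (comp_morphD pD (tmaprD bh)).
rewrite (tmapr_pure bh); apply: (etrans (congr1 (tmap id _) (pullS y m u))).
by apply: (etrans _ (esym (pullS y m _))); rewrite -IH -leg12_natural // tmapr_pure.
Qed.

Lemma pull_braid_perm y k (w : 'S_k) (x : tpow G k) :
  tmap id (@braid_perm A G sigma k w) (pull y x) = pull y (braid_perm sigma w x).
Proof.
rewrite /braid_perm; case: pickP => [t _|_]; last exact: tmapr_id.
elim: (val t) x => [|i s IH] x; first exact: tmapr_id.
set f := foldr _ _ _ in IH *.
have fh : bimod_hom f by elim: s @f {IH} => [|j s IHs] //=; exact: bimod_hom_comp (braid_at_hom j k) IHs.
rewrite /= -/f -pull_braid_at -IH tmapr_comp //; apply: bimod_homl => //.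
exact: braid_at_hom.
Qed.

(** The signs are central, so they move freely between the tensor factors. *)
Lemma pull_antisym y k (x : tpow G k) :
  tmap id (@antisym A G sigma k) (pull y x) = pull y (antisym sigma x).
Proof.
have [pD pZ] := pull_homl y k.
rewrite /antisym (morph_sum pD) -/(antisym sigma).
under eq_bigr => w _ do rewrite pZ -pull_braid_perm.
have ah := bimod_homl (antisym_hom k).
move: (pull y x); apply: tens_ext => [s t|s t|m u]; first exact: tmaprD.
  rewrite -big_split; apply: eq_bigr => w _ /=.
  by rewrite (tmaprD (bimod_homl (braid_perm_hom w))) scalerDr.
rewrite tmapr_pure // /antisym (morph_sum (pureDr m)).
apply: eq_bigr => w _; rewrite (tmapr_pure (bimod_homl (braid_perm_hom w))).
rewrite pureZ -pure_bal; congr (_ \ot _); rewrite -signr_odd.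
by case: (odd _); rewrite ?scale1r ?ract1 // scaleN1r (morphN (ractDr m)) ract1.
Qed.
End Braiding.
End Pull.

(** * Flatness of a finitely generated projective module *)

(** A dual basis for the right action: G is finitely generated projective, hence flat,
    as a right A-module. *)
Record dual_basis (A : nzRingType) (G : bimodType A) n (e : 'I_n -> G) (c : 'I_n -> G -> A) : Prop :=
  DualBasis {
  dualD : forall i, {morph c i : x y / x + y};
  dualR : forall i x a, c i (x :* a) = c i x * a;
  dualE : forall x, x = \sum_i e i :* c i x
}.

Section Flatness.
Variables (A : nzRingType) (G : bimodType A) (n : nat) (e : 'I_n -> G) (c : 'I_n -> G -> A).
Hypothesis ec : dual_basis e c.

Definition coord (N : bimodType A) (i : 'I_n) : btens G N -> N :=
  tlift (fun x y => c i x *: y).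

Let bal (N : bimodType A) i : balanced (fun x (y : N) => c i x *: y).
Proof.
split=> [x x' y|x y y'|x a y]; first by rewrite (dualD ec) scalerDl.
  exact: scalerDr.
by rewrite (dualR ec) scalerA.
Qed.

Lemma coordD (N : bimodType A) i : {morph @coord N i : s t / s + t}.
Proof. exact: tliftD (bal N i). Qed.

Lemma coord_pure (N : bimodType A) i (x : G) (y : N) : coord i (x \ot y) = c i x *: y.
Proof. exact: tlift_pure (bal N i) _ _. Qed.

(** Tensoring the dual basis expansion: an element of G (x) N has a normal form,
    natural in N by coord_tmap. *)
Lemma coordE (N : bimodType A) (t : btens G N) : t = \sum_i e i \ot coord i t.
Proof.
move: t; apply: tens_ext => // [s t|x y].
  by rewrite -big_split; apply: eq_bigr => i _; rewrite coordD pureDr.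
rewrite {1}[x](dualE ec) (morph_sum (fun x x' => pureDl x x' y)).
by apply: eq_bigr => i _; rewrite pure_bal coord_pure.
Qed.

Lemma coord_tmap (N N' : bimodType A) (f : N -> N') i t : left_hom f ->
  coord i (tmap id f t) = f (coord i t).
Proof.
move=> fh; have [fD fZ] := fh; move: t; apply: tens_ext.
- exact: (comp_morphD (@coordD N' i) (tmaprD fh)).
- exact: (comp_morphD fD (@coordD N i)).
by move=> x y; rewrite tmapr_pure // !coord_pure fZ.
Qed.

(** Flatness in the form in which it is used: an inclusion of equalizers survives
    tensoring with G on the left, because it can be tested on coordinates. *)
Lemma tmapr_eq_ker (N N1 N2 : bimodType A) (f f' : N -> N1) (h h' : N -> N2) t :
    left_hom f -> left_hom f' -> left_hom h -> left_hom h' ->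
    (forall y, f y = f' y -> h y = h' y) ->
  tmap (@id G) f t = tmap id f' t -> tmap (@id G) h t = tmap id h' t.
Proof.
move=> fh fh' hh hh' ker eft.
rewrite [t]coordE !(morph_sum (tmaprD _)) //; apply: eq_bigr => i _.
rewrite !tmapr_pure //; congr (_ \ot _); apply: ker.
by rewrite -!coord_tmap // eft.
Qed.
End Flatness.

(** * Moving a one-form through the tensor algebra *)

Section PullAlg.
Variables (A : nzRingType) (G : bimodType A) (T : btens G G -> btens G G).
Hypothesis Th : bimod_hom T.

Notation TA := (tensor_alg G).

Definition tinj k (u : tpow G k) : TA := dinj u.

Lemma tinj_homl k : left_hom (@tinj k).
Proof. by split=> [|a u]; [exact: dinjD|exact: dinjZ]. Qed.

Lemma tinjR k (u : tpow G k) a : tinj (u :* a) = tinj u :* a.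
Proof. exact: dinjR. Qed.

Definition tinj1 (m : G) : TA := tinj (m \ot (1 : A^o) : tpow G 1).

Lemma tinj0_mul (a : A^o) (x : TA) : tinj (a : tpow G 0) \bm x = (a : A) *: x.
Proof.
move: x; apply: dsum_ext => [x y|x y|k u]; rewrite ?bmulDr ?scalerDr //.
by rewrite mul_dinj -dinjZ.
Qed.

Lemma tinj1_mul k (m : G) (u : tpow G k) : tinj1 m \bm tinj u = tinj (m \ot u : tpow G k.+1).
Proof.
rewrite mul_dinj tcatS; congr (@tinj k.+1 (_ \ot _)); exact: scale1r.
Qed.

(** The tensor algebra is generated by A and by the one-forms. *)
Lemma tensor_alg_ind (P : TA -> Prop) :
    (forall x y, P x -> P y -> P (x + y)) -> (forall x y, P x -> P y -> P (x \bm y)) ->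
    (forall a : A^o, P (tinj (a : tpow G 0))) -> (forall m, P (tinj1 m)) ->
  forall x, P x.
Proof.
move=> PD PM P0 P1; have P00 : P 0 by have := P0 0; rewrite [tinj _](morph0 (proj1 (tinj_homl 0))).
elim/dsum_ind=> // k u x Px; apply: (PD) => //; elim: k u {x Px} => [|k IH] u; first exact: P0.
elim/tens_ind: u => [|m u t Pt]; first by rewrite dinj0.
by rewrite dinjD; apply: (PD) => //; rewrite -[dinj _]tinj1_mul; exact: PM.
Qed.

Definition pull_alg (y : G) : TA -> btens G TA :=
  dlift (fun k u => tmap id (@tinj k) (pull T y u)).

Let pull_alg_add y k : {morph (fun u : tpow G k => tmap id (@tinj k) (pull T y u)) : u v / u + v}.
Proof. exact: (comp_morphD (tmaprD (tinj_homl k)) (proj1 (pull_homl Th y k))). Qed.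

Lemma pull_algD y : {morph pull_alg y : u v / u + v}.
Proof. exact: dliftD (pull_alg_add y). Qed.

Lemma pull_alg_tinj y k (u : tpow G k) : pull_alg y (tinj u) = tmap id (@tinj k) (pull T y u).
Proof. exact: dlift_dinj (pull_alg_add y) _ _. Qed.

Lemma pull_alg_homl y : left_hom (pull_alg y).
Proof.
split=> [|a]; first exact: pull_algD.
apply: dsum_ext => [u v|u v|k u]; rewrite ?scalerDr ?pull_algD ?scalerDr //.
rewrite -[dinj u]/(tinj u) -(proj2 (tinj_homl k)) !pull_alg_tinj (proj2 (pull_homl Th y k)).
by rewrite (proj2 (tmapr_homl _ (tinj_homl k))).
Qed.

Lemma pull_algDy x : {morph (fun y => pull_alg y x) : y y' / y + y'}.
Proof.
move=> y y'; move: x; apply: dsum_ext => [u v|u v|k u]; rewrite ?pull_algD //.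
  by rewrite addrACA.
by rewrite -[dinj u]/(tinj u) !pull_alg_tinj (pullDy Th) (tmaprD (tinj_homl k)).
Qed.

Lemma pull_algR y a x : pull_alg (y :* a) x = pull_alg y x :* a.
Proof.
move: x; apply: dsum_ext => [u v|u v|k u]; rewrite ?pull_algD ?ractDl //.
rewrite -[dinj u]/(tinj u) !pull_alg_tinj (pullR Th) (tmapr_homr (tinj_homl k)) // => v.
exact: tinjR.
Qed.

Lemma pull_alg_bal y a x : pull_alg (a *: y) x = pull_alg y (x :* a).
Proof.
move: x; apply: dsum_ext => [u v|u v|k u]; rewrite ?ractDl ?pull_algD //.
by rewrite -[dinj u]/(tinj u) -tinjR !pull_alg_tinj (pull_bal Th).
Qed.
End PullAlg.

Section RightMul.
Variables (A : nzRingType) (G : bimodType A) (C : bimodAlgType A).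

Lemma bmulr_homl (v : C) : left_hom (fun w : C => w \bm v).
Proof. by split=> [w w'|a w]; [exact: bmulDl|exact: bmulZ]. Qed.

(** If [P z] is the result of moving z from the right to the left of some x, then
    act_through P moves the leading one-form of t to the left of x, and multiplies
    what is left behind with the rest of t. *)
Definition act_through (P : G -> btens G C) (t : btens G C) : btens G C :=
  tlift (fun z v => tmap id (fun w => w \bm v) (P z)) t.

Variable P : G -> btens G C.
Hypothesis PD : {morph P : z z' / z + z'}.
Hypothesis PR : forall z a, P (z :* a) = P z :* a.

Lemma act_through_eq0 t : (forall z, P z = 0) -> act_through P t = 0.
Proof.
move=> P0; rewrite /act_through /tlift big1 // => p _.
by rewrite P0 (morph0 (tmaprD (bmulr_homl _))).
Qed.

Let bal : balanced (fun z v => tmap id (fun w : C => w \bm v) (P z)).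
Proof.
have mD v := tmaprD (M := G) (bmulr_homl v).
have mE v (x : G) := tmapr_pure (bmulr_homl v) x.
split=> [z z' v|z v v'|z a v]; first by rewrite PD mD.
  move: (P z); apply: tens_ext => [s t|s t|x w]; rewrite ?mD //.
    by rewrite addrACA.
  by rewrite !mE bmulDr pureDr.
rewrite PR; move: (P z); apply: tens_ext => [s t|s t|x w]; rewrite ?ractDl ?mD //.
by rewrite pureR !mE bmul_bal.
Qed.

Lemma act_throughD : {morph act_through P : s t / s + t}.
Proof. exact: tliftD bal. Qed.

Lemma act_through0 : act_through P 0 = 0.
Proof. exact: morph0 act_throughD. Qed.

Lemma act_through_pure z v : act_through P (z \ot v) = tmap id (fun w => w \bm v) (P z).
Proof. exact: tlift_pure bal _ _. Qed.
End RightMul.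

Section PullMul.
Variables (A : nzRingType) (G : bimodType A) (T : btens G G -> btens G G).
Hypothesis Th : bimod_hom T.
Notation TA := (tensor_alg G).

Let ath (x : TA) := act_through (fun z => pull_alg T z x).

Let athD x : {morph ath x : s t / s + t}.
Proof.
by apply: act_throughD => [z z'|z a]; [exact: pull_algDy|exact: pull_algR].
Qed.

Let ath_pure x z v : ath x (z \ot v) = tmap id (fun w => w \bm v) (pull_alg T z x).
Proof.
by apply: act_through_pure => [z1 z'|z1 a]; [exact: pull_algDy|exact: pull_algR].
Qed.

Let ath_mulr x t v : ath x (tmap id (fun w => w \bm v) t) = tmap id (fun w => w \bm v) (ath x t).
Proof.
have mD := tmaprD (M := G) (bmulr_homl v); move: t; apply: tens_ext.
- exact: (comp_morphD (athD x) mD).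
- exact: (comp_morphD mD (athD x)).
move=> z w; rewrite (tmapr_pure (bmulr_homl v)) !ath_pure tmapr_comp; try exact: bmulr_homl.
by apply: eq_tmapr => u; rewrite bmulA.
Qed.

(** The condition on x is stable under sums and products, so it suffices to take x in A
    or a one-form; for a one-form it is the recursion that defines pull. *)
Lemma pull_alg_mul y (x x' : TA) : pull_alg T y (x \bm x') = ath x (pull_alg T y x').
Proof.
elim/tensor_alg_ind: x y x' => [x1 x2 IH1 IH2|x1 x2 IH1 IH2|a|m] y x'.
- rewrite bmulDl (pull_algD Th) IH1 IH2; move: (pull_alg T y x').
  apply: tens_ext => [s t|s t|z v]; rewrite ?athD //; first by rewrite addrACA.
  by rewrite !ath_pure (pull_algD Th) (tmaprD (bmulr_homl v)).
- rewrite -bmulA IH1 IH2; move: (pull_alg T y x').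
  apply: tens_ext => [s t|s t|z v]; rewrite ?athD //.
  by rewrite !ath_pure IH1 ath_mulr.
- rewrite tinj0_mul (proj2 (pull_alg_homl Th y)); move: (pull_alg T y x').
  apply: tens_ext => [s t|s t|z v]; rewrite ?scalerDr ?athD //.
  rewrite ath_pure pull_alg_tinj // /= (tmapr_pure (tinj_homl G 0)) (tmapr_pure (bmulr_homl v)).
  by rewrite tinj0_mul scale1r pureZ.
move: x'; apply: dsum_ext => [u v|u v|k u]; rewrite ?bmulDr ?(pull_algD Th) ?athD //.
rewrite -[dinj u]/(tinj u) tinj1_mul !pull_alg_tinj //.
apply: (etrans (congr1 (tmap id _) (pullS Th y m u))).
have ih j := tinj_homl G j; have legD (P : bimodType A) := proj1 (leg12_homl Th P).
move: (pull T y u); apply: tens_ext.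
- exact: (comp_morphD (comp_morphD (tmaprD (ih k.+1)) (legD _)) (pureDr m)).
- exact: (comp_morphD (athD _) (tmaprD (ih k))).
move=> z w; rewrite (tmapr_pure (ih k)) ath_pure leg12_pure // pull_alg_tinj //.
rewrite (pullS Th) /= scale1r leg12_pure //.
have th := @left_hom_tail A G; rewrite !tmapr_comp //; try exact: bmulr_homl.
- by apply: eq_tmapr => v /=; rewrite tinj1_mul.
- exact: left_hom_comp (bmulr_homl _) (ih 1).
- exact: th.
- exact: (ih 1).
- exact: (ih k.+1).
exact: th.
Qed.
End PullMul.

(** * Freeness of a left-covariant calculus *)

Section LeftCovariant.
Variables (R : realType) (A : algType R[i]) (H : hopf_star_alg A).
Variables (G : bimodType A) (calc : star_calculus H G).
Local Notation "M \tensC N" := (btens (cbim M) (cbim N)) (at level 40).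
Local Notation "x \otC[ M ] y" := (@pure R[i] (cbim A^o) (cbim M) x y)
  (at level 40, format "x  \otC[ M ]  y").

Lemma linear_morphD (K : nzRingType) (U V : lmodType K) (f : U -> V) :
  linear f -> {morph f : x y / x + y}.
Proof. by move=> fl x y; have := fl 1 x y; rewrite !scale1r. Qed.

Lemma linear_morphZ (K : nzRingType) (U V : lmodType K) (f : U -> V) c :
  linear f -> {morph f : x / c *: x}.
Proof.
move=> fl x; have := fl c x 0; rewrite !addr0 => ->.
by rewrite (morph0 (linear_morphD fl)) addr0.
Qed.

Section TensAct.
Variable M : lmodType A.

Let bal_in (a b : A) : balanced (fun (a' : cbim A^o) (m : cbim M) =>
  (a * (a' : A)) \otC[M] (b *: (m : M))).
Proof.
split=> [x x' y|x y y'|x c y].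
- by rewrite mulrDr pureDl.
- by rewrite scalerDr pureDr.
rewrite -[x :* c]/(c%:A * (x : A)) -[c *: y]/(c%:A *: (y : M)) scalerA.
rewrite mulr_algl mulr_algr -scalerAr -(mulr_algl c (_ * _)) -(mulr_algl c b) -scalerA.
exact: (@pure_bal R[i] (cbim A^o) (cbim M) (a * (x : A)) c (b *: (y : M))).
Qed.

Let act_in (a b : A) (t : A^o \tensC M) : A^o \tensC M :=
  tlift (fun (a' : cbim A^o) (m : cbim M) =>
    ((a : A) * (a' : A)) \otC[M] ((b : A) *: (m : M))) t.

Let act_inD a b : {morph act_in a b : s t / s + t}.
Proof. exact: tliftD (bal_in a b). Qed.

Let act_inE a b (a' : A) (m : M) : act_in a b (a' \otC[M] m) = (a * a') \otC[M] (b *: m).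
Proof. exact: (tlift_pure (bal_in a b)). Qed.

Let bal_out t : balanced (fun a b : cbim A^o => act_in a b t).
Proof.
split=> [a a' b|a b b'|a c b]; move: t; apply: tens_ext.
- exact: act_inD.
- exact: (add_morphD (act_inD _ _) (act_inD _ _)).
- by move=> x y; rewrite !act_inE mulrDl pureDl.
- exact: act_inD.
- exact: (add_morphD (act_inD _ _) (act_inD _ _)).
- by move=> x y; rewrite !act_inE scalerDl pureDr.
- exact: act_inD.
- exact: act_inD.
move=> x y; rewrite !act_inE.
rewrite -[a :* c]/(c%:A * (a : A)) -[c *: b]/(c%:A * (b : A)) -mulrA -scalerA.
exact: (@pure_bal R[i] (cbim A^o) (cbim M) ((a : A) * (x : A)) c ((b : A) *: (y : M))).
Qed.

Lemma tens_act_pure a b (a' : A) (m : M) :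
  tens_act (a \otC[A^o] b) (a' \otC[M] m) = (a * a') \otC[M] (b *: m).
Proof. by rewrite [LHS](tlift_pure (bal_out _)) act_inE. Qed.

Lemma tens_actDl (t : A^o \tensC M) :
  {morph (fun s => tens_act s t) : s s' / s + s'}.
Proof. exact: tliftD (bal_out t). Qed.

Lemma tens_actDr (s : A^o \tensC A^o) : {morph @tens_act R A M s : t t' / t + t'}.
Proof.
move=> t t'; move: s; apply: tens_ext => [s s'|s s'|x y]; rewrite ?tens_actDl //.
  by rewrite addrACA.
by rewrite /tens_act !(tlift_pure (bal_out _)) act_inD.
Qed.

End TensAct.

(** With the multiplicativity of the coproduct this makes the coaction left covariant
    (coactlZ), although only its values on a db are prescribed. *)
Lemma tens_actA (M : lmodType A) (s t : A^o \tensC A^o) (u : A^o \tensC M) :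
  tens_act (tens_act s t) u = tens_act s (tens_act t u).
Proof.
move: s; apply: tens_ext => [s s'|s s'|a b]; rewrite ?tens_actDl //.
move: t; apply: tens_ext => [t t'|t t'|a' b'].
- by rewrite tens_actDr tens_actDl.
- by rewrite tens_actDl tens_actDr.
move: u; apply: tens_ext => [u u'|u u'|a2 m]; rewrite ?tens_actDr //.
by rewrite !tens_act_pure mulrA scalerA.
Qed.

Let coactlD := linear_morphD (coactl_linear calc).

Lemma coactlZ a (x : G) : coactl calc (a *: x) = tens_act (cop H a) (coactl calc x).
Proof.
have [s ->] := calc_gen calc x; rewrite scaler_sumr !(morph_sum coactlD).
rewrite (morph_sum (tens_actDr _)); apply: eq_bigr => p _.
by rewrite scalerA !coactl_diff copM tens_actA.
Qed.

Section Basis.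
Variables (n : nat) (theta : 'I_n -> G) (X : 'I_n -> A -> R[i]).
Hypothesis Hb : tangent_basis calc theta X.

Lemma theta_gen (x : G) : exists b : 'I_n -> A, x = \sum_i b i *: theta i.
Proof.
have [s ->] := calc_gen calc x; elim: s => [|p s [b IH]].
  by exists (fun=> 0); rewrite big_nil big1 // => i _; rewrite scale0r.
exists (fun i => p.1 * sweedler (fun x y => X i y *: x) (cop H p.2) + b i).
rewrite big_cons IH {1}(diffE Hb) scaler_sumr -big_split.
by apply: eq_bigr => i _; rewrite scalerDl scalerA.
Qed.

Let S := antip H.
Let SD := linear_morphD (antip_linear H).

Let bal_anti : balanced (fun (a : cbim A^o) (x : cbim G) => S a *: (x : G)).
Proof.
split=> [a a' x|a x x'|a c x].
- by have -> : S (a + a') = S a + S a' := SD a a'; exact: scalerDl.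
- exact: scalerDr.
rewrite -[a :* c]/(c%:A * (a : A)) -[c *: x]/(c%:A *: (x : G)) mulr_algl.
by rewrite /S (linear_morphZ c (antip_linear H)) scalerA mulr_algr.
Qed.

(** Composed with the coaction this is the projection onto the left-invariant forms. *)
Definition anti_act : A^o \tensC G -> G := 
  tlift (fun (a : cbim A^o) (x : cbim G) => S a *: (x : G)).

Lemma anti_act_inv s (x : G) :
  anti_act (tens_act s ((1 : A) \otC[G] x)) = sweedler (fun a b => S a * b) s *: x.
Proof.
have aD := tliftD bal_anti.
have bal : @balanced R[i] (cbim A^o) (cbim A^o) A (fun a b => S a * (b : A)).
  split=> [a a' b|a b b'|a c b].
  - by have -> : S (a + a') = S a + S a' := SD a a'; exact: mulrDl.
  - exact: mulrDr.
  rewrite -[a :* c]/(c%:A * (a : A)) -[c *: b]/(c%:A * (b : A)) !mulr_algl.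
  by rewrite /S (linear_morphZ c (antip_linear H)) -scalerAl scalerAr.
move: s; apply: tens_ext => [s t|s t|a b].
- by rewrite tens_actDl /anti_act aD.
- by rewrite /sweedler (tliftD bal) scalerDl.
by rewrite tens_act_pure /anti_act (tlift_pure bal_anti) /sweedler (tlift_pure bal) mulr1 scalerA.
Qed.

(** By the antipode axiom, anti_act maps the coaction of [sum b_i theta_i] to
    [sum eps(b_i) theta_i], and the theta_i are linearly independent over the scalars. *)
Lemma theta_coun (b : 'I_n -> A) :
  \sum_i b i *: theta i = 0 -> forall i, coun H (b i) = 0.
Proof.
move=> b0; apply: (theta_free Hb).
have aD : {morph anti_act : s t / s + t} := tliftD bal_anti.
have e i : anti_act (coactl calc (b i *: theta i)) = (coun H (b i))%:A *: theta i.
  by rewrite coactlZ (theta_inv Hb) anti_act_inv (antipl H).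
under eq_bigr => i _ do rewrite -e.
rewrite -(morph_sum (f := fun x => anti_act (coactl calc x)) (comp_morphD aD coactlD)).
by rewrite b0 (morph0 coactlD) (morph0 aD).
Qed.

(** Chosen by means of theta_gen; that the choice is unique is lcoef_uniq. *)
Definition lcoef (x : G) : 'I_n -> A := sval (cid (theta_gen x)).

Lemma lcoefE x : x = \sum_i lcoef x i *: theta i.
Proof. exact: svalP (cid (theta_gen x)). Qed.

Lemma coun_linD : {morph coun H : a b / a + b}.
Proof. exact: linear_morphD (coun_linear H). Qed.

Lemma coun_linZ c a : coun H (c *: a) = c * coun H a.
Proof. exact: linear_morphZ (coun_linear H) _. Qed.

Lemma coun_lcoef (b : 'I_n -> A) x : x = \sum_i b i *: theta i ->
  forall i, coun H (lcoef x i) = coun H (b i).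
Proof.
move=> xE i; apply/eqP; rewrite -subr_eq0 -(morphB coun_linD); apply/eqP.
move: i; apply: theta_coun.
under eq_bigr => i _ do rewrite scalerBl.
by rewrite sumrB -lcoefE -xE subrr.
Qed.

(** The scalar coordinates of the invariant part of x.  Their linearity
    is available before the coefficients themselves are known to be unique. *)
Definition coun_coef i (x : G) : R[i] := coun H (lcoef x i).

Let coun_coefD i : {morph coun_coef i : x y / x + y}.
Proof.
move=> x y; rewrite /coun_coef -coun_linD.
apply: (coun_lcoef (b := fun i => lcoef x i + lcoef y i)).
rewrite {1}[x]lcoefE {1}[y]lcoefE -big_split.
by apply: eq_bigr => j _; rewrite scalerDl.
Qed.

Let coun_coefZ i c x : coun_coef i (c%:A *: x) = c * coun_coef i x.
Proof.
rewrite /coun_coef -coun_linZ -(mulr_algl c (lcoef x i)).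
apply: (coun_lcoef (b := fun i => c%:A * lcoef x i)).
by rewrite {1}[x]lcoefE scaler_sumr; apply: eq_bigr => j _; rewrite scalerA.
Qed.

Lemma coun_coef_theta i j b : coun_coef i (b *: theta j) = if j == i then coun H b else 0.
Proof.
have := @coun_lcoef (fun k => if k == j then b else 0) (b *: theta j).
rewrite /coun_coef => ->; first by rewrite eq_sym; case: eqP => // _; exact: morph0 coun_linD.
rewrite (bigD1 j) //= eqxx big1 ?addr0 // => k /negPf ->; exact: scale0r.
Qed.

Let bal_coef i : balanced (fun (a : cbim A^o) (x : cbim G) => coun_coef i x *: (a : A)).
Proof.
split=> [a a' x|a x x'|a c x]; first exact: scalerDr.
  by rewrite coun_coefD scalerDl.
rewrite -[a :* c]/(c%:A * (a : A)) -[c *: x]/(c%:A *: (x : G)) mulr_algl coun_coefZ.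
by rewrite scalerA mulrC.
Qed.

(** Apply coun_coef i to the second leg of the coaction of the relation: since
    [coun_coef i (b theta_j)] is eps(b) for i = j and 0 otherwise, the counit axiom
    leaves b_i. *)
Lemma theta_free_left (b : 'I_n -> A) :
  \sum_i b i *: theta i = 0 -> forall i, b i = 0.
Proof.
move=> b0 i; have pD := tliftD (bal_coef i); have pE := tlift_pure (bal_coef i).
have : tlift (fun (a : cbim A^o) (x : cbim G) => coun_coef i x *: (a : A))
    (coactl calc (\sum_j b j *: theta j)) = 0.
  by rewrite b0 (morph0 coactlD) (morph0 pD).
rewrite (morph_sum coactlD) (morph_sum pD).
have bal : @balanced R[i] (cbim A^o) (cbim A^o) A (fun x y => coun H y *: (x : A)).
  split=> [a a' x|a x x'|a c x]; first exact: scalerDr.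
    by have -> : coun H (x + x') = coun H x + coun H x' := coun_linD x x'; exact: scalerDl.
  rewrite -[a :* c]/(c%:A * (a : A)) -[c *: x]/(c%:A * (x : A)) !mulr_algl coun_linZ.
  by rewrite scalerA mulrC.
have e j s : tlift (fun (a : cbim A^o) (x : cbim G) => coun_coef i x *: (a : A))
    (tens_act s ((1 : A) \otC[G] theta j)) =
    if j == i then sweedler (fun x y => coun H y *: x) s else 0.
  move: s; apply: tens_ext => [s t|s t|x y].
  - by rewrite tens_actDl pD.
  - by case: eqP => _; rewrite ?addr0 // /sweedler (tliftD bal).
  rewrite tens_act_pure pE coun_coef_theta mulr1 /sweedler (tlift_pure bal).
  by case: eqP => _ //; exact: scale0r.
rewrite (bigD1 i) //= big1 => [|j /negPf ji]; last first.
  by rewrite coactlZ (theta_inv Hb) e ji.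
by rewrite addr0 coactlZ (theta_inv Hb) e eqxx (counr H).
Qed.

Lemma lcoef_uniq (b : 'I_n -> A) x : x = \sum_i b i *: theta i ->
  forall i, lcoef x i = b i.
Proof.
move=> xE i; apply/eqP; rewrite -subr_eq0; apply/eqP; move: i; apply: theta_free_left.
under eq_bigr => i _ do rewrite scalerBl.
by rewrite sumrB -lcoefE -xE subrr.
Qed.

(** The involution exchanges left and right multiplication, so the left basis theta
    becomes a right basis. *)
Lemma gstar_dual_basis : dual_basis (fun i => gstar calc (theta i))
  (fun i x => star H (lcoef (gstar calc x) i)).
Proof.
split=> [i x y|i x a|x].
- rewrite gstarD -(starD H); congr (star H _).
  apply: (lcoef_uniq (b := fun i => lcoef (gstar calc x) i + lcoef (gstar calc y) i)).
  rewrite {1}[gstar calc x]lcoefE {1}[gstar calc y]lcoefE -big_split.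
  by apply: eq_bigr => j _; rewrite scalerDl.
- rewrite gstarR -[X in _ * X](starK H) -(starM H); congr (star H _).
  apply: (lcoef_uniq (b := fun i => star H a * lcoef (gstar calc x) i)).
  rewrite {1}[gstar calc x]lcoefE scaler_sumr.
  by apply: eq_bigr => j _; rewrite scalerA.
rewrite -{1}[x](gstarK calc) {1}[gstar calc x]lcoefE (morph_sum (gstarD calc)).
by apply: eq_bigr => i _; rewrite gstarZ.
Qed.
End Basis.
End LeftCovariant.

(** * Connections on an inner calculus *)

Section InnerConnection.
Variables (R : realType) (A : algType R[i]) (H : hopf_star_alg A).
Variables (G : bimodType A) (calc : star_calculus H G).
Variables (omega : G) (T : btens G G -> btens G G) (nabla : G -> btens G G).
Hypothesis inner : forall a : A, diff calc a = omega :* a - a *: omega.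
Hypothesis Th : bimod_hom T.
Hypothesis nablaE : forall x : G, nabla x = omega \ot x - T (x \ot omega).

Lemma pureBl (M N : bimodType A) (x x' : M) (y : N) : (x - x') \ot y = x \ot y - x' \ot y.
Proof. exact: (morphB (f := fun x => x \ot y) (fun x x' => pureDl x x' y)). Qed.

(** In the step from k to k + 1 the term [T(m (x) omega) (x) u] of the connection on the
    first factor cancels the image of [m (x) omega (x) u] under T_12. *)
Lemma conn_powE k (x : tpow G k) :
  conn_pow calc nabla T x = omega \ot x - pull T omega x.
Proof.
elim: k x => [|k IH] x; first by rewrite /= inner pureBl pure_bal [_ *: 1]mulr1.
have lD (P : bimodType A) := proj1 (leg12_homl Th P).
have fE : (fun (m : G) (u : tpow G k) =>
      tassoc (nabla m \ot u) + leg12 T (m \ot conn_pow calc nabla T u)) =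
    (fun (m : G) (u : tpow G k) => omega \ot (m \ot u) - leg12 T (m \ot pull T omega u)).
  apply: funext => m; apply: funext => u.
  have th := left_hom_tail G u.
  rewrite nablaE IH pureBl (morphB (@tassocD _ _ _ _)) !tassoc_pure tmapr_pure //.
  rewrite (morphB (pureDr m)) (morphB (lD _)) leg12_pure //.
  by rewrite addrA subrK.
rewrite /= fE; have pD := proj1 (pull_homl Th omega k.+1).
have bal : balanced (fun (m : G) (u : tpow G k) =>
    omega \ot (m \ot u) - leg12 T (m \ot pull T omega u)).
  have [qD qZ] := pull_homl Th omega k.
  split=> [m m' u|m u u'|m a u].
  - by rewrite !pureDl pureDr lD opprD addrACA.
  - by rewrite qD !pureDr lD opprD addrACA.
  - by rewrite qZ !pure_bal.
move: x; apply: tens_ext.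
- exact: tliftD bal.
- exact: (sub_morphD (pureDr omega) pD).
move=> m u; rewrite (tlift_pure bal); congr (_ - _).
exact: (esym (pullS Th omega m u)).
Qed.

Lemma conn_pow_add k : {morph @conn_pow R A H G calc nabla T k : x y / x + y}.
Proof.
move=> x y; rewrite !conn_powE pureDr (proj1 (pull_homl Th omega k)) opprD.
by rewrite addrACA.
Qed.

Lemma conn_algE (x : tensor_alg G) :
  conn_alg calc nabla T x = omega \ot x - pull_alg T omega x.
Proof.
have iD k := tmaprD (M := G) (tinj_homl G k).
have add k := comp_morphD (iD k) (@conn_pow_add k).
move: x; apply: dsum_ext => [|x y|k u]; first exact: (dliftD add).
  by rewrite pureDr pull_algD // opprD addrACA.
rewrite [LHS](dlift_dinj add) conn_powE (morphB (iD k)) (tmapr_pure (tinj_homl G k)).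
by rewrite -pull_alg_tinj.
Qed.

Lemma diff_scalar (c : R[i]) : diff calc c%:A = 0.
Proof. by rewrite inner -(calc_central calc); exact: subrr. Qed.

(** Since [da = omega a - a omega], a left linear P is all that is needed to turn
    [omega (x) x - P x] into a left connection. *)
Lemma inner_left_connection (C : bimodType A) (P : C -> btens G C) (D : C -> btens G C) :
  left_hom P -> (forall x, D x = omega \ot x - P x) -> left_connection calc D.
Proof.
move=> [PD PZ] DE; have DD : {morph D : x y / x + y}.
  by move=> x y; rewrite !DE PD pureDr opprD addrACA.
have Dl a x : D (a *: x) = diff calc a \ot x + a *: D x.
  rewrite !DE inner pureBl pure_bal PZ scalerBr pureZ.
  by rewrite addrA subrK.
split=> // c x y; rewrite DD; congr (_ + _).
by rewrite -[c *: x]/(c%:A *: (x : C)) Dl diff_scalar pure0l add0r.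
Qed.

(** An abstract version of pull on an algebra C: Q u y is the result of moving y to the
    left of u. *)
Section AlgebraConnection.
Variables (C : bimodAlgType A) (Q : C -> G -> btens G C).
Hypothesis Qh : forall y, left_hom (Q^~ y).
Hypothesis QDy : forall u, {morph Q u : y y' / y + y'}.
Hypothesis QR : forall u y a, Q u (y :* a) = Q u y :* a.
Hypothesis Qbal : forall u y a, Q (u :* a) y = Q u (a *: y).
Hypothesis QM : forall u u' y, Q (u \bm u') y = act_through (Q u) (Q u' y).

Let Q_balanced : balanced Q.
Proof. by split=> *; [exact: (proj1 (Qh _))|exact: QDy|exact: Qbal]. Qed.

Let tau : btens C G -> btens G C := tlift Q.

Let tauE u y : tau (u \ot y) = Q u y.
Proof. exact: (tlift_pure Q_balanced). Qed.

Let tau_hom : bimod_hom tau.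
Proof.
have tD : {morph tau : s t / s + t} := tliftD Q_balanced.
split=> // a; apply: tens_ext => [s t|s t|u y];
  rewrite ?scalerDr ?ractDl ?tD ?scalerDr ?ractDl //.
  by rewrite pureZ !tauE (proj2 (Qh y)).
by rewrite pureR !tauE QR.
Qed.

Let mu : btens C C -> C := tlift (fun u v : C => u \bm v).

Let mu_balanced : balanced (fun u v : C => u \bm v).
Proof. by split=> *; [exact: bmulDl|exact: bmulDr|exact: bmul_bal]. Qed.

Let mu_homl : left_hom mu.
Proof.
have mD : {morph mu : s t / s + t} := tliftD mu_balanced.
split=> // a; apply: tens_ext => [s t|s t|u v]; rewrite ?scalerDr ?mD ?scalerDr //.
by rewrite pureZ /mu !(tlift_pure mu_balanced) bmulZ.
Qed.

Let mu_tail v t : tmap id mu (tmap id (fun u => u \ot v) t) =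
  tmap (@id G) (fun u => u \bm v) t.
Proof.
rewrite tmapr_comp //; last exact: left_hom_tail.
by apply: eq_tmapr => u; rewrite /mu (tlift_pure mu_balanced).
Qed.

Let mu_leg u t : tmap id mu (leg12 tau (u \ot t)) = act_through (Q u) t.
Proof.
have mD := tmaprD (M := G) mu_homl; have lD := proj1 (leg12_homl tau_hom C).
move: t; apply: tens_ext => [||z v].
- exact: (comp_morphD (comp_morphD mD lD) (pureDr u)).
- exact: (act_throughD (QDy u) (QR u)).
by rewrite leg12_pure // mu_tail tauE (act_through_pure (QDy u) (QR u)).
Qed.

(** In the product rule the two terms with omega between u and v cancel, and what
    remains is the multiplicativity of Q. *)
Lemma inner_alg_connection :
  alg_left_connection calc (fun u => omega \ot u - Q u omega) tau.
Proof.
have aD u := act_throughD (QDy u) (QR u).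
split; first split=> //.
- exact: (inner_left_connection (Qh omega)).
- move=> u a; rewrite tauE inner (morphB (QDy u)) QR -Qbal.
  rewrite (morphB (f := fun x => x :* a) (ractDl a)) pureR.
  by rewrite opprB [RHS]addrC addrA subrK.
move=> u v; rewrite (tmaprD mu_homl) tassoc_pure mu_tail mu_leg.
rewrite (morphB (aD u)) -QM (act_through_pure (QDy u) (QR u)).
rewrite (morphB (tmaprD (bmulr_homl v))) (tmapr_pure (bmulr_homl v)).
by rewrite addrA subrK.
Qed.
End AlgebraConnection.

Lemma descend (M N : Type) (Z : Type) (p : M -> N) (f : M -> Z) :
    (forall y, exists x, p x = y) -> (forall x x', p x = p x' -> f x = f x') ->
  exists f' : N -> Z, forall x, f' (p x) = f x.
Proof.
move=> ps fp; exists (fun y => f (sval (cid (ps y)))) => x.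
by apply: fp; exact: svalP (cid (ps (p x))).
Qed.

(** * The exterior algebra *)

Section Exterior.
Variables (n : nat) (e : 'I_n -> G) (c : 'I_n -> G -> A).
Hypothesis ec : dual_basis e c.
Variable sigma : btens G G -> btens G G.
Hypothesis sh : bimod_hom sigma.
Hypothesis sT : forall t : btens G (btens G G),
  leg23 sigma (leg12 T (leg23 T t)) = leg12 T (leg23 T (leg12 sigma t)).

Lemma conn_pow_antisym k (x : tpow G k) :
  tmap id (@antisym A G sigma k) (conn_pow calc nabla T x) =
  conn_pow calc nabla T (antisym sigma x).
Proof.
have ah := bimod_homl (antisym_hom sh k).
by rewrite !conn_powE (morphB (tmaprD ah)) tmapr_pure // pull_antisym.
Qed.

Lemma conn_pow_ker_antisym k (x : tpow G k) : antisym sigma x = 0 ->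
  tmap id (@antisym A G sigma k) (conn_pow calc nabla T x) = 0.
Proof. by rewrite conn_pow_antisym => ->; rewrite (morph0 (@conn_pow_add k)). Qed.

Local Notation antisym0 k := (bspan (fun x : tpow G k => antisym sigma x = 0)).

Lemma antisym_bspan k (x : tpow G k) : x \in antisym0 k -> antisym sigma x = 0.
Proof.
have [aD aZ aR] := antisym_hom sh k.
rewrite unfold_in => /asboolP; elim=> {x} [//||x y _ ex _ ey|a x _ ex|a x _ ex].
- exact: morph0 aD.
- by rewrite aD ex ey addr0.
- by rewrite aZ ex scaler0.
- by rewrite aR ex ract0l.
Qed.

(** The step that needs flatness: pull y x is annihilated by id (x) A_k, and this has
    to be upgraded to its vanishing modulo ker A_k in the second factor. *)
Lemma pull_ext_pow y k (x : tpow G k) : antisym sigma x = 0 ->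
  tmap id (bproj (antisym0 k)) (pull T y x) = 0.
Proof.
move=> x0; have ah := bimod_homl (antisym_hom sh k).
have ph := bimod_homl (bproj_hom (antisym0 k)).
have zh (N : bimodType A) : left_hom (fun _ : tpow G k => 0 : N).
  by split=> [u v|a u]; rewrite ?addr0 ?scaler0.
have z0 (N : bimodType A) (t : btens G (tpow G k)) : tmap id (fun=> 0 : N) t = 0.
  rewrite [t](coordE ec) (morph_sum (tmaprD (zh _))) big1 // => i _.
  by rewrite tmapr_pure ?pure0r.
rewrite -[RHS](z0 _ (pull T y x)).
apply: (tmapr_eq_ker ec ah (zh (tpow G k)) ph (zh _)).
  move=> u u0; rewrite -[RHS](morph0 (proj1 ph)); apply/bprojP.
  by rewrite subr0 unfold_in; apply/asboolP; exact: bspan_in.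
by rewrite z0 pull_antisym // x0 (morph0 (proj1 (pull_homl Th y k))).
Qed.

Local Notation EA := (ext_alg sigma).

Let ext_injD k : {morph (fun x : tpow G k =>
  dinj (bproj (antisym0 k) x : ext_pow sigma k) : EA) : x y / x + y}.
Proof. by move=> x y; rewrite bprojD dinjD. Qed.

Lemma ext_projD : {morph ext_proj sigma : x y / x + y}.
Proof. exact: dliftD ext_injD. Qed.

Lemma ext_proj_tinj k (u : tpow G k) :
  ext_proj sigma (tinj u) = dinj (bproj (antisym0 k) u : ext_pow sigma k).
Proof. exact: (dlift_dinj ext_injD). Qed.

Lemma ext_proj_homl : left_hom (ext_proj sigma).
Proof.
split=> [|a]; first exact: ext_projD.
apply: dsum_ext => [x y|x y|k u]; rewrite ?scalerDr ?ext_projD ?scalerDr //.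
rewrite -[dinj u]/(tinj u) -(proj2 (tinj_homl G k)) !ext_proj_tinj.
by have [_ hZ _] := bproj_hom (antisym0 k); rewrite hZ dinjZ.
Qed.

Lemma ext_proj_coef (x : tensor_alg G) k : ext_proj sigma x k = bproj (antisym0 k) (x k).
Proof.
move: x; apply: dsum_ext => [x y|x y|j u].
- by rewrite ext_projD.
- by rewrite -bprojD.
rewrite -[dinj u]/(tinj u) ext_proj_tinj; have [<-|jk] := eqVneq j k.
  by rewrite !dinj_id.
rewrite !dinj_neq //; exact: (esym (morph0 (@bprojD _ _ _))).
Qed.

Lemma ext_proj_surj (y : EA) : exists x, ext_proj sigma x = y.
Proof.
elim/dsum_ind: y => [|k v y [x <-]]; first by exists 0; exact: morph0 ext_projD.
have [u <-] := bproj_surj v; exists (tinj u + x).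
by rewrite ext_projD ext_proj_tinj.
Qed.

Lemma ext_proj_pull_alg y (x : tensor_alg G) : ext_proj sigma x = 0 ->
  tmap id (ext_proj sigma) (pull_alg T y x) = 0.
Proof.
move=> x0; have ph := ext_proj_homl.
pose f k (u : tpow G k) := tmap (@id G) (ext_proj sigma) (pull_alg T y (tinj u)).
have fD k : {morph @f k : u v / u + v}.
  apply: (comp_morphD (comp_morphD (tmaprD ph) (pull_algD Th y))).
  exact: (proj1 (tinj_homl G k)).
have -> : tmap id (ext_proj sigma) (pull_alg T y x) = dlift f x.
  move: {x0} x; apply: dsum_ext => [||k u]; last by rewrite dlift_dinj.
    exact: (comp_morphD (tmaprD ph) (pull_algD Th y)).
  exact: dliftD fD.
rewrite /dlift big1 // => k _; rewrite /f pull_alg_tinj // tmapr_comp //; last exact: tinj_homl.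
have bh := bimod_homl (bproj_hom (antisym0 k)).
rewrite (eq_tmapr (h := fun u => (dinj (bproj (antisym0 k) u : ext_pow sigma k) : EA)));
  last exact: ext_proj_tinj.
have dh : left_hom (fun u : ext_pow sigma k => dinj u : EA).
  by split=> [u v|a u]; [exact: dinjD|exact: dinjZ].
rewrite -(tmapr_comp _ dh bh) pull_ext_pow ?(morph0 (tmaprD dh)) //.
apply: antisym_bspan; rewrite -[x k]subr0; apply/bprojP.
rewrite -ext_proj_coef x0; exact: (esym (morph0 (@bprojD _ _ _))).
Qed.

Lemma ext_connection : exists2 nablaW : EA -> btens G EA,
  left_connection calc nablaW &
  forall x : tensor_alg G, nablaW (ext_proj sigma x) =
    tmap id (@ext_proj A G sigma) (conn_alg calc nabla T x).
Proof.
have ph := ext_proj_homl.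
have [P PE] : exists P : EA -> btens G EA,
    forall x, P (ext_proj sigma x) = tmap id (ext_proj sigma) (pull_alg T omega x).
  apply: descend => [|x x' exx]; first exact: ext_proj_surj.
  apply/eqP; rewrite -subr_eq0 -(morphB (tmaprD ph)) -(morphB (pull_algD Th omega)).
  by rewrite ext_proj_pull_alg // (morphB ext_projD) exx subrr.
exists (fun y => omega \ot y - P y) => [|x]; last first.
  by rewrite PE conn_algE (morphB (tmaprD ph)) tmapr_pure.
apply: (inner_left_connection (P := P)) => //.
split=> [y y'|a y].
  have [[x <-] [x' <-]] := (ext_proj_surj y, ext_proj_surj y').
  by rewrite -ext_projD !PE (pull_algD Th) (tmaprD ph).
have [x <-] := ext_proj_surj y; rewrite -(proj2 ph) !PE (proj2 (pull_alg_homl Th _)).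
by rewrite (proj2 (tmapr_homl G ph)).
Qed.
End Exterior.

(** * The Clifford algebra *)

Section CliffordConnection.
Variables (n : nat) (e : 'I_n -> G) (c : 'I_n -> G -> A).
Hypothesis ec : dual_basis e c.
Variables (sigma : btens G G -> btens G G) (g : btens G G -> A^o).
Hypothesis sh : bimod_hom sigma.
Hypothesis gh : bimod_hom g.
Hypothesis sT : forall t : btens G (btens G G),
  leg23 sigma (leg12 T (leg23 T t)) = leg12 T (leg23 T (leg12 sigma t)).
Hypothesis gT : forall t : btens G (btens G G),
  form23 g (leg12 T (leg23 T t)) = form12 g t.

Local Notation Cl := (clifford sigma g).
Local Notation pr := (clifford_proj sigma g).

Lemma clifford_proj_hom : bimod_hom pr.
Proof. exact: (bproj_hom (ideal_gen (clifford_rel sigma g))). Qed.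

Let prh := bimod_homl clifford_proj_hom.

Lemma clifford_proj_surj (y : Cl) : exists x, pr x = y.
Proof. exact: bproj_surj. Qed.

Lemma clifford_projM x x' : pr (x \bm x') = pr x \bm pr x'.
Proof. exact: aprojM. Qed.

Lemma clifford_proj0 x : pr x = 0 <-> x \in ideal_gen (clifford_rel sigma g).
Proof.
rewrite -(morph0 (proj1 prh)); split=> [/bprojP|x0]; first by rewrite subr0.
by apply/bprojP; rewrite subr0.
Qed.

Lemma form12_pure (P : bimodType A) (t : btens G G) (z : P) :
  form12 g (tmap id (fun y => y \ot z) t) = (g t : A) *: z.
Proof.
have [gD gZ gR] := gh.
have bal : balanced (fun u (z : P) => (g u : A) *: z).
  split=> [u u' v|u v v'|u a v]; first by rewrite gD scalerDl.
    exact: scalerDr.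
  by rewrite gR -[_ :* a]/((g u : A) * a) scalerA.
move: t; apply: tens_ext => [s t|s t|x y].
- by rewrite (tmaprD (left_hom_tail _ _)) /form12 tassocVD (tliftD bal).
- by rewrite gD scalerDl.
by rewrite (tmapr_pure (left_hom_tail _ _)) /form12 tassocV_pure (tlift_pure bal).
Qed.

Lemma form23_pure (z : G) (u : btens G G) : form23 g (z \ot u) = z :* (g u : A).
Proof.
have [gD gZ gR] := gh; rewrite [LHS]tlift_pure //.
split=> [z1 z2 v|z1 v v'|z1 a v]; first exact: ractDl.
  by rewrite gD ractDr.
by rewrite ractA gZ.
Qed.

Lemma form23D : {morph form23 (P := G) g : s t / s + t}.
Proof.
have [gD gZ gR] := gh; apply: tliftD.
split=> [z1 z2 v|z1 v v'|z1 a v]; first exact: ractDl.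
  by rewrite gD ractDr.
by rewrite ractA gZ.
Qed.

Let deg2 : btens G G -> tensor_alg G := fun t => tinj (tpow2_of t : tpow G 2).
Let deg0 : btens G G -> tensor_alg G := fun t => tinj (g t : tpow G 0).

Let deg2_homl : left_hom deg2.
Proof.
apply: left_hom_comp (tinj_homl G 2) _; apply: (tmapr_homl G).
exact: (left_hom_tail G (1 : A^o)).
Qed.

Let deg0_homl : left_hom deg0.
Proof. exact: left_hom_comp (tinj_homl G 0) (bimod_homl gh). Qed.

Lemma pull_alg_deg2 y t :
  pull_alg T y (deg2 t) = tmap id deg2 (leg12 T (leg23 T (tmap id (fun m => m \ot y) t))).
Proof.
have th1 := left_hom_tail G (1 : A^o).
have thh := tmapr_homl G th1.
rewrite pull_alg_tinj // /tpow2_of.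
have -> := pull_tail2 Th y (1 : tpow G 0) t.
rewrite -(tmapr_comp _ (tinj_homl G 2) thh) -leg12_leg12_tail // -leg23_leg12_tail //.
congr (tmap id _ (leg12 T (tmap id _ _))); rewrite tmapr_comp //; last exact: left_hom_tail.
by apply: eq_tmapr => m; rewrite tmapr_pure //= scale1r.
Qed.

(** Scalars in the second factor can be absorbed by the first one. *)
Lemma tmapr_deg0 (s : btens G (btens G G)) :
  tmap id deg0 s = (form23 g s : G) \ot tinj (1 : tpow G 0).
Proof.
move: s; apply: tens_ext => [|s t|z u]; first exact: (tmaprD deg0_homl).
  by rewrite form23D pureDl.
rewrite form23_pure (tmapr_pure deg0_homl) pure_bal -(proj2 (tinj_homl G 0)).
by congr (_ \ot tinj (_ : tpow G 0)); exact: (esym (mulr1 _)).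
Qed.

Lemma pull_alg_deg0 y t :
  pull_alg T y (deg0 t) =
  tmap id deg0 (leg12 T (leg23 T (tmap id (fun m => m \ot y) t))).
Proof.
by rewrite tmapr_deg0 gT form12_pure pull_alg_tinj // (tmapr_pure (tinj_homl G 0)).
Qed.

(** Here s is T_12 T_23 applied to t (x) y.  By flatness it is a sum of z (x) u with
    sigma(u) = u, and the two parts of the relation at t become the two parts of the
    relations at these u. *)
Lemma clifford_rel_pull_alg y x : clifford_rel sigma g x ->
  tmap id pr (pull_alg T y x) = 0.
Proof.
move=> [t st ->]; rewrite -/(deg2 t) -/(deg0 t).
rewrite (morphB (pull_algD Th y)) pull_alg_deg2 pull_alg_deg0 (morphB (tmaprD prh)).
set s := leg12 T _.
have ss : tmap id sigma s = tmap id id s.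
  rewrite tmapr_id /s -[tmap id sigma _]/(leg23 sigma _) sT.
  by rewrite leg12_tail // st.
apply/eqP; rewrite subr_eq0; apply/eqP.
rewrite !tmapr_comp //.
apply: (tmapr_eq_ker ec (bimod_homl sh) (left_hom_id _)
   (left_hom_comp prh deg2_homl) (left_hom_comp prh deg0_homl) _ ss) => u su.
apply: (subr0_eq); rewrite -(morphB (proj1 prh)); apply/clifford_proj0.
by rewrite unfold_in; apply/asboolP/ideal_in; exists u.
Qed.

Let pr_pull x z := tmap id pr (pull_alg T z x).

Let pr_pullD x : {morph pr_pull x : z z' / z + z'}.
Proof. exact: (comp_morphD (tmaprD prh) (pull_algDy Th x)). Qed.

Let pr_pullR x z a : pr_pull x (z :* a) = pr_pull x z :* a.
Proof.
rewrite /pr_pull (pull_algR Th) (tmapr_homr prh) //.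
by have [_ _ hR] := clifford_proj_hom; exact: hR.
Qed.

(** pull_alg_mul modulo the Clifford ideal: the right-hand side depends on x' only
    through its image, and on x only through pr_pull x. *)
Lemma clifford_proj_pull_alg_mul y x x' :
  pr_pull (x \bm x') y = act_through (pr_pull x) (pr_pull x' y).
Proof.
rewrite {1 3}/pr_pull (pull_alg_mul Th); move: (pull_alg T y x').
have aD : {morph act_through (fun z => pull_alg T z x) : s t / s + t}.
  by apply: act_throughD => [|z a]; [exact: pull_algDy|exact: pull_algR].
have aE z v : act_through (fun z => pull_alg T z x) (z \ot v) =
    tmap id (fun w => w \bm v) (pull_alg T z x).
  by apply: act_through_pure => [|z' a]; [exact: pull_algDy|exact: pull_algR].
have aD' := act_throughD (pr_pullD x) (pr_pullR x).
apply: tens_ext => [||z v].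
- exact: (comp_morphD (tmaprD prh) aD).
- exact: (comp_morphD aD' (tmaprD prh)).
have mh (C : bimodAlgType A) (w : C) := bmulr_homl w.
rewrite aE (tmapr_pure prh) (act_through_pure (pr_pullD x) (pr_pullR x)) /pr_pull.
by rewrite !tmapr_comp //; apply: eq_tmapr => w; exact: clifford_projM.
Qed.

Lemma clifford_proj_pull_alg y x : pr x = 0 -> tmap id pr (pull_alg T y x) = 0.
Proof.
move=> /clifford_proj0; rewrite unfold_in => /asboolP x0.
elim: x0 y => {x} [x rx||x x' _ IH _ IH'|x x' _ IH'|x x' _ IH] y.
- exact: clifford_rel_pull_alg rx.
- exact: (morph0 (comp_morphD (tmaprD prh) (pull_algD Th y))).
- by rewrite (pull_algD Th) (tmaprD prh) IH IH' addr0.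
- rewrite -[LHS]/(pr_pull _ _) clifford_proj_pull_alg_mul [pr_pull x' y]IH'.
  exact: (act_through0 (pr_pullD x) (pr_pullR x)).
by rewrite -[LHS]/(pr_pull _ _) clifford_proj_pull_alg_mul act_through_eq0.
Qed.

Lemma clifford_connection :
  exists (nablaC : Cl -> btens G Cl) (tauC : btens Cl G -> btens G Cl),
    alg_left_connection calc nablaC tauC /\
    forall x : tensor_alg G,
      nablaC (clifford_proj sigma g x) =
      tmap id (@clifford_proj A G sigma g) (conn_alg calc nabla T x).
Proof.
have [prD prZ prR] := clifford_proj_hom.
have [Q QE] : exists Q : Cl -> G -> btens G Cl, forall x, Q (pr x) = pr_pull x.
  apply: descend => [|x x' exx]; first exact: clifford_proj_surj.
  apply: funext => y; apply/eqP; rewrite -subr_eq0 /pr_pull -(morphB (tmaprD prh)).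
  by rewrite -(morphB (pull_algD Th y)) clifford_proj_pull_alg // (morphB prD) exx subrr.
have surj := clifford_proj_surj.
have Qh y : left_hom (Q^~ y).
  split=> [u u'|a u].
    have [[x <-] [x' <-]] := (surj u, surj u').
    by rewrite -prD !QE /pr_pull (pull_algD Th) (tmaprD prh).
  have [x <-] := surj u; rewrite -prZ !QE /pr_pull (proj2 (pull_alg_homl Th _)).
  by rewrite (proj2 (tmapr_homl G prh)).
have QDy u : {morph Q u : y y' / y + y'}.
  by have [x <-] := surj u; rewrite QE; exact: pr_pullD.
have QR u y a : Q u (y :* a) = Q u y :* a.
  by have [x <-] := surj u; rewrite QE pr_pullR.
have Qbal u y a : Q (u :* a) y = Q u (a *: y).
  by have [x <-] := surj u; rewrite -prR !QE /pr_pull (pull_alg_bal Th).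
have QM u u' y : Q (u \bm u') y = act_through (Q u) (Q u' y).
  have [[x <-] [x' <-]] := (surj u, surj u').
  by rewrite -clifford_projM !QE clifford_proj_pull_alg_mul.
exists (fun u => omega \ot u - Q u omega), (tlift Q).
split; last by move=> x; rewrite QE conn_algE (morphB (tmaprD prh)) tmapr_pure.
exact: (inner_alg_connection Qh QDy QR Qbal QM).
Qed.
End CliffordConnection.
End InnerConnection.

Theorem proposition4p4
  (R : realType) (A : algType R[i]) (H : hopf_star_alg A) (Hcoss : cosemisimple H)
  (G : bimodType A) (calc : star_calculus H G)
  (n : nat) (theta : 'I_n -> G) (X : 'I_n -> A -> R[i])
  (Hbasis : tangent_basis calc theta X) (HX : S2_invariant H X)
  (F : 'M[R[i]]_n) (s2 : G -> G) (Hs2 : is_S2 H theta X F s2)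
  (sigma sigmaV : btens G G -> btens G G) (Hsigma : is_braiding calc s2 sigma sigmaV)
  (g : btens G G -> A^o) (Hg : is_sigma_metric calc s2 sigma sigmaV g)
  (omega : G) (Hinner : forall a : A, diff calc a = omega :* a - a *: omega)
  (sigmat : btens G G -> btens G G) (Hsigmat : bimod_hom sigmat)
  (nabla : G -> btens G G) (Hnabla : linear_left_connection calc nabla sigmat)
  (Hform : forall x : G, nabla x = omega \ot x - sigmat (x \ot omega)) :
  ((forall t : btens G (btens G G),
      leg23 sigma (leg12 sigmat (leg23 sigmat t)) =
      leg12 sigmat (leg23 sigmat (leg12 sigma t))) ->
   (forall (k : nat) (x : tpow G k), antisym sigma x = 0 ->
      tmap id (@antisym A G sigma k) (conn_pow calc nabla sigmat x) = 0) /\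
   exists2 nablaW : ext_alg sigma -> btens G (ext_alg sigma),
     left_connection calc nablaW &
     forall x : tensor_alg G,
       nablaW (ext_proj sigma x) =
       tmap id (@ext_proj A G sigma) (conn_alg calc nabla sigmat x))
  /\
  ((forall t : btens G (btens G G),
      leg23 sigma (leg12 sigmat (leg23 sigmat t)) =
      leg12 sigmat (leg23 sigmat (leg12 sigma t))) ->
   (forall t : btens G (btens G G),
      form23 g (leg12 sigmat (leg23 sigmat t)) = form12 g t) ->
   exists (nablaC : clifford sigma g -> btens G (clifford sigma g))
          (tauC : btens (clifford sigma g) G -> btens G (clifford sigma g)),
     alg_left_connection calc nablaC tauC /\
     forall x : tensor_alg G,
       nablaC (clifford_proj sigma g x) =
       tmap id (@clifford_proj A G sigma g) (conn_alg calc nabla sigmat x)).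
Proof.
have ec := gstar_dual_basis Hbasis.
have sh := sigma_hom Hsigma; have gh := metric_hom Hg.
split=> [sT|sT gT].
  split=> [k x|].
    exact: (conn_pow_ker_antisym Hinner Hsigmat Hform sh sT).
  exact: (ext_connection Hinner Hsigmat Hform ec sh sT).
exact: (clifford_connection Hinner Hsigmat Hform ec sh gh sT gT).
Qed.
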